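(* Let $R$ be a spherical random walk on a $2$-dimensional lattice $Z\subset\mathbb{C}\cong\mathbb{R}^2$, with harmonic potential $a$. Then for every integer $K\ge1$ there are real constants $\alpha,\lambda$ and complex coefficients $\alpha_{lk}$, indexed by a finite set of integer pairs $(l,k)$ with $l\ge0$, $k\ge0$, $-K\le l-k\le-1$, such that \[ a(z)=\alpha\log|z|+\lambda+\operatorname{Re}\Big(\sum\alpha_{lk}\frac{z^l}{|z|^k}\Big)+O(|z|^{-K})\qquad(z\in Z,\ |z|\to\infty), \] and moreover $\alpha_{lk}=0$ whenever $l<\tfrac12 k$.
   Context: A random walk on a lattice $Z$: $R_0=0$, $R_n=X_1+\dots+X_n$ with $X_i$ i.i.d. $Z$-valued, every $z\in Z$ reachable with positive probability. It is spherical if it is bounded ($X_1$ bounded), balanced ($\mathbb{E}X_1=0$), and $\mathbb{E}\langle X_1,e_i\rangle\langle X_1,e_j\rangle=C\delta_{ij}$ for some constant $C$ (the $e_i$ standard unit vectors). The harmonic potential is $a(z)=\sum_{n\ge0}(P_n(0)-P_n(z))$ with $P_n(z)=\mathbb{P}(R_n=z)$. *)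

(* Defs.v *)
From Stdlib Require Import Reals ZArith List.
From Coquelicot Require Import Coquelicot.
Open Scope R_scope.

(* A 2-dimensional lattice in C: Z = { m v1 + n v2 : m, n integers },
   with v1, v2 R-linearly independent.  Lattice points are coded by their
   integer coordinates (m, n). *)
Definition lattice_basis (v1 v2 : C) : Prop :=
  fst v1 * snd v2 - snd v1 * fst v2 <> 0.

Definition emb (v1 v2 : C) (z : Z * Z) : C :=
  Cplus (Cmult (RtoC (IZR (fst z))) v1) (Cmult (RtoC (IZR (snd z))) v2).

Definition zsub (z w : Z * Z) : Z * Z := ((fst z - fst w)%Z, (snd z - snd w)%Z).

Definition lsum {A : Type} (f : A -> R) (l : list A) : R :=
  fold_right (fun a acc => f a + acc) 0 l.

(* Step law: p w = P(X_1 = w) for lattice points w; supp is a duplicate-free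
   list containing every point of positive probability (X_1 bounded). *)
Definition step_law (p : Z * Z -> R) (supp : list (Z * Z)) : Prop :=
  NoDup supp /\ (forall w, 0 <= p w) /\ (forall w, p w <> 0 -> In w supp)
  /\ lsum p supp = 1.

(* P_n(z) = P(R_n = z): n-fold convolution of the step law (R_0 = 0). *)
Fixpoint Pn (p : Z * Z -> R) (supp : list (Z * Z)) (n : nat) (z : Z * Z) : R :=
  match n with
  | O => if (Z.eqb (fst z) 0 && Z.eqb (snd z) 0)%bool then 1 else 0
  | S n' => lsum (fun w => p w * Pn p supp n' (zsub z w)) supp
  end.

Definition spherical (v1 v2 : C) (p : Z * Z -> R) (supp : list (Z * Z)) : Prop :=
  lsum (fun w => p w * fst (emb v1 v2 w)) supp = 0 /\
  lsum (fun w => p w * snd (emb v1 v2 w)) supp = 0 /\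
  exists c : R,
    lsum (fun w => p w * (fst (emb v1 v2 w) * fst (emb v1 v2 w))) supp = c /\
    lsum (fun w => p w * (snd (emb v1 v2 w) * snd (emb v1 v2 w))) supp = c /\
    lsum (fun w => p w * (fst (emb v1 v2 w) * snd (emb v1 v2 w))) supp = 0.

Definition irreducible_walk (p : Z * Z -> R) (supp : list (Z * Z)) : Prop :=
  forall z : Z * Z, exists n : nat, 0 < Pn p supp n z.

Definition harm_pot (p : Z * Z -> R) (supp : list (Z * Z)) (z : Z * Z) : R :=
  Series (fun n => Pn p supp n (0%Z, 0%Z) - Pn p supp n z).

Fixpoint cpow (z : C) (n : nat) : C :=
  match n with O => RtoC 1 | S n' => Cmult z (cpow z n') end.

Definition expansion (coef : nat * nat -> C) (idx : list (nat * nat)) (z : C) : C :=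
  fold_right (fun lk acc =>
    Cplus (Cmult (coef lk) (Cmult (cpow z (fst lk)) (RtoC (/ (Cmod z ^ snd lk))))) acc)
    (RtoC 0) idx.

(* Main.v *)
(* The idea is to build a fundamental solution A of the walk, (P - 1) A = delta, with the
   required expansion at infinity; no Fourier analysis is used.

   Writing zeta = 1 / conj z, one Taylor expansion gives
   (P - 1) (z^a zeta^b) = - a b sigma z^(a-1) zeta^(b+1) + (terms smaller by a factor 1/|z|),
   sphericity killing all other second-order terms.  Hence log |z| can be corrected order by
   order by monomials z^a zeta^b (a < b) into a function G with g = (P - 1) G = O(|z|^-N).
   Modulo discrete derivatives g equals s delta, and s <> 0: otherwise the iterates T^n G (0)
   of the lazy walk T = (1 + P) / 2 would stay bounded, while G tends to infinity.  Therefore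
   some finite combination nu * g agrees with delta up to a rapidly decaying f which is a sum
   of m-th order discrete derivatives, m as large as we wish.  Since each discrete derivative
   gains a factor n^(-1/2) under T^n, H = sum_n T^n f converges and is O(|z|^-K); then
   A = nu * G - H / 2.  Finally the partial sums of the harmonic potential telescope:
   sum_(k<n) (P_k(0) - P_k(z)) = A(z) - A(0) + P^n (A(.) - A(. + z)) (0), and the last term
   vanishes in the limit because A has decaying gradient and P_n(x) -> 0. *)

Require Import Defs.
From Stdlib Require Import Reals ZArith List Lra Lia FunctionalExtensionality.
From Coquelicot Require Import Coquelicot.
Open Scope R_scope.

(** The lazy walk is there because of parity: iterates of [P] may oscillate between sublattices, so
    a difference along a single step need not decay. Standing still with probability 1/2 pairs every
    possible step [w] with the origin, which makes [w] a smoothing direction, and T - 1 = (P - 1) /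
    2 costs only a factor 2. For [P] itself differences of possible steps smooth, which is enough
    for P_n(x) -> 0.

    The vanishing for l < k / 2 is built into the monomials: z^a zeta^b = z^(a+b) / |z|^(2b), so l =
    a + b >= b = k / 2. The correction scheme never leaves this family: an error term z^a zeta^b has
    b >= a + 3 and is cancelled by a multiple of z^(a+1) zeta^(b-1), with nonzero divisor (a+1)(b-1)
    sigma.

    A combination [nu] is used because [g] agrees with s delta only up to first differences, too few
    for a heat flow sum that decays like |z|^-K. *)

Notation pt := (Z * Z)%type.

(** * Lattice subtraction and finite sums over lists *)

Lemma zsub_0_r (z : pt) : zsub z (0, 0)%Z = z.
Proof. destruct z; unfold zsub; simpl; now rewrite !Z.sub_0_r. Qed.

Lemma zsub_comm (z v w : pt) : zsub (zsub z v) w = zsub (zsub z w) v.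
Proof. unfold zsub; simpl; f_equal; ring. Qed.

Lemma lsum_ext {A} (f g : A -> R) l :
  (forall a, In a l -> f a = g a) -> lsum f l = lsum g l.
Proof.
  induction l as [|a l IH]; intros H; simpl; auto.
  rewrite (H a), IH; auto; [intros; apply H; now right | now left].
Qed.

Lemma lsum_scal {A} c (f : A -> R) l : lsum (fun a => c * f a) l = c * lsum f l.
Proof. induction l as [|a l IH]; simpl; [ring | rewrite IH; ring]. Qed.

Lemma lsum_plus {A} (f g : A -> R) l :
  lsum (fun a => f a + g a) l = lsum f l + lsum g l.
Proof. induction l as [|a l IH]; simpl; [ring | rewrite IH; ring]. Qed.

Lemma lsum_le {A} (f g : A -> R) l :
  (forall a, In a l -> f a <= g a) -> lsum f l <= lsum g l.
Proof.
  induction l as [|a l IH]; intros H; simpl; [lra|].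
  apply Rplus_le_compat; [apply H; now left | apply IH; intros; apply H; now right].
Qed.

Lemma lsum_nonneg {A} (f : A -> R) l :
  (forall a, In a l -> 0 <= f a) -> 0 <= lsum f l.
Proof.
  induction l as [|a l IH]; intros H; simpl; [lra|].
  apply Rplus_le_le_0_compat; [apply H; now left | apply IH; intros; apply H; now right].
Qed.

Lemma lsum_abs {A} (f : A -> R) l : Rabs (lsum f l) <= lsum (fun a => Rabs (f a)) l.
Proof.
  induction l as [|a l IH]; simpl; [rewrite Rabs_R0; lra|].
  eapply Rle_trans; [apply Rabs_triang | lra].
Qed.

Lemma lsum_app {A} (f : A -> R) l l' : lsum f (l ++ l') = lsum f l + lsum f l'.
Proof. induction l as [|a l IH]; simpl; [ring | rewrite IH; ring]. Qed.

Lemma lsum_map {A B} (f : B -> R) (g : A -> B) l :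
  lsum f (map g l) = lsum (fun a => f (g a)) l.
Proof. induction l as [|a l IH]; simpl; [reflexivity | now rewrite IH]. Qed.

Lemma lsum_split {A} (f : A -> R) l1 a l2 :
  lsum f (l1 ++ a :: l2) = f a + lsum f (l1 ++ l2).
Proof. rewrite !lsum_app; simpl; ring. Qed.

Lemma lsum_ge_elem {A} (f : A -> R) l a :
  (forall b, In b l -> 0 <= f b) -> In a l -> f a <= lsum f l.
Proof.
  intros H Ha; destruct (in_split _ _ Ha) as (l1 & l2 & ->).
  rewrite lsum_split.
  assert (0 <= lsum f (l1 ++ l2)); [|lra].
  apply lsum_nonneg; intros b Hb; apply H.
  apply in_app_iff in Hb; apply in_app_iff; simpl; tauto.
Qed.

(** * Finitely supported signed measures acting by convolution *)

Definition act (mu : list (R * pt)) (f : pt -> R) (z : pt) : R :=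
  lsum (fun cw => fst cw * f (zsub z (snd cw))) mu.

Arguments act : simpl never.

Definition delta : pt -> R := fun z =>
  if (Z.eqb (fst z) 0 && Z.eqb (snd z) 0)%bool then 1 else 0.

Definition prob (mu : list (R * pt)) : Prop :=
  (forall cw, In cw mu -> 0 <= fst cw) /\ lsum fst mu = 1.

Definition grad (w : pt) : list (R * pt) := (1, (0, 0)%Z) :: (-1, w) :: nil.

Definition half (w : pt) : list (R * pt) := (/2, (0, 0)%Z) :: (/2, w) :: nil.

Definition scale (c : R) (mu : list (R * pt)) := map (fun cw => (c * fst cw, snd cw)) mu.

Lemma grad_eq w f z : act (grad w) f z = f z - f (zsub z w).
Proof. unfold act; simpl; rewrite zsub_0_r; ring. Qed.

Lemma half_eq w f z : act (half w) f z = (f z + f (zsub z w)) / 2.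
Proof. unfold act; simpl; rewrite zsub_0_r; field. Qed.

Lemma act_plus mu f g : act mu (fun z => f z + g z) = fun z => act mu f z + act mu g z.
Proof.
  extensionality z; unfold act; rewrite <- lsum_plus.
  apply lsum_ext; intros; ring.
Qed.

Lemma act_scal mu c f : act mu (fun z => c * f z) = fun z => c * act mu f z.
Proof.
  extensionality z; unfold act; rewrite <- lsum_scal.
  apply lsum_ext; intros; ring.
Qed.

Lemma act_minus mu f g : act mu (fun z => f z - g z) = fun z => act mu f z - act mu g z.
Proof.
  replace (fun z => f z - g z) with (fun z => f z + (-1) * g z)
    by (extensionality z; ring).
  rewrite act_plus, act_scal; extensionality z; ring.
Qed.

Lemma act_shift mu f w : act mu (fun z => f (zsub z w)) = fun z => act mu f (zsub z w).
Proof.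
  extensionality z; unfold act; apply lsum_ext; intros.
  now rewrite zsub_comm.
Qed.

Lemma act_cons c w mu f : act ((c, w) :: mu) f = fun z => c * f (zsub z w) + act mu f z.
Proof. reflexivity. Qed.

Lemma act_app mu nu f : act (mu ++ nu) f = fun z => act mu f z + act nu f z.
Proof. extensionality z; apply lsum_app. Qed.

Lemma act_scale c mu f : act (scale c mu) f = fun z => c * act mu f z.
Proof.
  extensionality z; unfold act, scale; rewrite lsum_map, <- lsum_scal.
  apply lsum_ext; intros; simpl; ring.
Qed.

(** Both sides are double sums over pairs of atoms, and translations commute. Every exchange of a
    difference operator with the heat flow rests on this. *)
Lemma act_comm mu nu f : act mu (act nu f) = act nu (act mu f).
Proof.
  induction mu as [|[c w] mu IH].
  - extensionality z; change (act nil (act nu f) z) with 0.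
    change (act nil f) with (fun _ : pt => 0); unfold act.
    induction nu as [|[d v] nu IHn]; simpl; [reflexivity | rewrite <- IHn; ring].
  - rewrite !act_cons, IH.
    rewrite act_plus, act_scal, act_shift; reflexivity.
Qed.

Lemma act_iter_comm nu mu n f :
  act nu (Nat.iter n (act mu) f) = Nat.iter n (act mu) (act nu f).
Proof. induction n as [|n IH]; simpl; [reflexivity | now rewrite act_comm, IH]. Qed.

Lemma iter_plus mu n f g :
  Nat.iter n (act mu) (fun z => f z + g z) =
  fun z => Nat.iter n (act mu) f z + Nat.iter n (act mu) g z.
Proof. induction n as [|n IH]; simpl; [reflexivity | now rewrite IH, act_plus]. Qed.

Lemma iter_scal mu n c f :
  Nat.iter n (act mu) (fun z => c * f z) = fun z => c * Nat.iter n (act mu) f z.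
Proof. induction n as [|n IH]; simpl; [reflexivity | now rewrite IH, act_scal]. Qed.

Lemma act_le mu f g z : prob mu ->
  (forall cw, In cw mu -> f (zsub z (snd cw)) <= g (zsub z (snd cw))) ->
  act mu f z <= act mu g z.
Proof.
  intros [Hpos _] H; apply lsum_le; intros cw Hcw.
  apply Rmult_le_compat_l; auto.
Qed.

Lemma act_abs_le mu f B z :
  (forall cw, In cw mu -> Rabs (f (zsub z (snd cw))) <= B) ->
  Rabs (act mu f z) <= lsum (fun cw => Rabs (fst cw)) mu * B.
Proof.
  intros H; unfold act; eapply Rle_trans; [apply lsum_abs|].
  rewrite Rmult_comm, <- lsum_scal; apply lsum_le; intros cw Hcw.
  rewrite Rabs_mult, Rmult_comm; apply Rmult_le_compat_r; auto using Rabs_pos.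
Qed.

Lemma act_contract mu f B z : prob mu ->
  (forall cw, In cw mu -> Rabs (f (zsub z (snd cw))) <= B) -> Rabs (act mu f z) <= B.
Proof.
  intros [Hpos H1] H; eapply Rle_trans; [apply act_abs_le, H|].
  rewrite (lsum_ext _ fst); [rewrite H1; lra|].
  intros; apply Rabs_pos_eq; auto.
Qed.

Lemma act_const mu c z : prob mu -> act mu (fun _ => c) z = c.
Proof.
  intros [_ H]; unfold act.
  rewrite (lsum_ext _ (fun cw => c * fst cw)) by (intros; ring).
  rewrite lsum_scal, H; ring.
Qed.

Lemma iter_const mu n c z : prob mu -> Nat.iter n (act mu) (fun _ => c) z = c.
Proof.
  intros H; revert z; induction n as [|n IH]; intros z; simpl; auto.
  transitivity (act mu (fun _ => c) z); [f_equal; extensionality x; apply IH | now apply act_const].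
Qed.

Lemma iter_contract mu n f B : prob mu ->
  (forall z, Rabs (f z) <= B) -> forall z, Rabs (Nat.iter n (act mu) f z) <= B.
Proof.
  intros Hmu H; induction n as [|n IH]; simpl; auto.
  intros z; apply act_contract; auto.
Qed.

Lemma iter_le mu n f g : prob mu -> (forall z, f z <= g z) ->
  forall z, Nat.iter n (act mu) f z <= Nat.iter n (act mu) g z.
Proof.
  intros Hmu H; induction n as [|n IH]; simpl; auto.
  intros z; apply act_le; auto.
Qed.

(** * Smoothing: gradients of iterates decay like [n^(-1/2)] *)

(* Mean of [h] under the binomial law with [n] fair trials. *)
Fixpoint coin (n : nat) (h : nat -> R) : R :=
  match n with
  | O => h O
  | S n' => (coin n' h + coin n' (fun i => h (S i))) / 2
  end.

Lemma coin_le n : forall h h', (forall i, h i <= h' i) -> coin n h <= coin n h'.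
Proof.
  induction n as [|n IH]; intros h h' H; simpl; auto.
  assert (A := IH h h' H).
  assert (B := IH (fun i => h (S i)) (fun i => h' (S i)) (fun i => H (S i))); lra.
Qed.

Lemma coin_plus n : forall h h', coin n (fun i => h i + h' i) = coin n h + coin n h'.
Proof.
  induction n as [|n IH]; intros h h'; simpl; auto.
  rewrite IH, (IH (fun i => h (S i)) (fun i => h' (S i))); lra.
Qed.

Lemma coin_scal n c : forall h, coin n (fun i => c * h i) = c * coin n h.
Proof.
  induction n as [|n IH]; intros h; simpl; auto.
  rewrite IH, (IH (fun i => h (S i))); lra.
Qed.

Lemma coin_const n c : coin n (fun _ => c) = c.
Proof. induction n as [|n IH]; simpl; [reflexivity | rewrite IH; lra]. Qed.

Lemma coin_ext n h h' : (forall i, h i = h' i) -> coin n h = coin n h'.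
Proof.
  intros H; apply Rle_antisym; apply coin_le; intros i; rewrite H; lra.
Qed.

(** Under fair tosses [a - 2 i] has mean [a - n] and variance [n]. Keeping [a] free lets the
    induction absorb the shift by 2 that a successful toss causes. *)
Lemma coin_variance n : forall a,
  coin n (fun i => (a - 2 * INR i) ^ 2) = INR n + (a - INR n) ^ 2.
Proof.
  induction n as [|n IH]; intros a.
  - simpl; ring.
  - cbn [coin]; rewrite IH.
    rewrite (coin_ext n _ (fun i => ((a - 2) - 2 * INR i) ^ 2)).
    + rewrite IH, S_INR; field.
    + intros i; rewrite S_INR; ring.
Qed.

(* Discrete integration by parts against the binomial weights:
   [C(n,i) - C(n,i-1) = C(n+1,i) (n+1-2i)/(n+1)]. *)
Lemma coin_by_parts n : forall h,
  INR (S n) * (coin n h - coin n (fun i => h (S i))) =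
  2 * coin (S n) (fun i => (INR (S n) - 2 * INR i) * h i).
Proof.
  induction n as [|n IH]; intros h.
  - simpl; field.
  - assert (E1 := IH h); assert (E2 := IH (fun i => h (S i))); cbv beta in E2.
    change (coin (S (S n)) (fun i => (INR (S (S n)) - 2 * INR i) * h i)) with
      ((coin (S n) (fun i => (INR (S (S n)) - 2 * INR i) * h i) +
        coin (S n) (fun i => (INR (S (S n)) - 2 * INR (S i)) * h (S i))) / 2).
    rewrite (coin_ext (S n) (fun i => (INR (S (S n)) - 2 * INR i) * h i)
       (fun i => (INR (S n) - 2 * INR i) * h i + h i))
      by (intros i; rewrite (S_INR (S n)); ring).
    rewrite (coin_ext (S n) (fun i => (INR (S (S n)) - 2 * INR (S i)) * h (S i))
       (fun i => (INR (S n) - 2 * INR i) * h (S i) + (-1) * h (S i)))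
      by (intros i; rewrite (S_INR (S n)), (S_INR i); ring).
    rewrite !coin_plus, coin_scal.
    set (X := coin (S n) (fun i => (INR (S n) - 2 * INR i) * h i)) in *.
    set (Y := coin (S n) (fun i => (INR (S n) - 2 * INR i) * h (S i))) in *.
    rewrite (S_INR (S n)).
    replace X with (INR (S n) * (coin n h - coin n (fun i => h (S i))) / 2) by lra.
    replace Y with (INR (S n) * (coin n (fun i => h (S i)) - coin n (fun i => h (S (S i)))) / 2)
      by lra.
    cbn [coin]; field.
Qed.

(** After summation by parts the difference is a mean of [h] weighted by n + 1 - 2 i. The standard
    deviation of that weight is only sqrt(n + 1), which beats the factor n + 1 on the left. *)
Lemma coin_diff_bound n h B : (forall i, Rabs (h i) <= B) ->
  Rabs (coin n h - coin n (fun i => h (S i))) <= 2 * B / sqrt (INR n + 1).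
Proof.
  intros H.
  assert (HB : 0 <= B) by (eapply Rle_trans; [apply Rabs_pos | apply (H O)]).
  assert (Hn : 0 < INR n + 1) by (assert (A := pos_INR n); lra).
  set (q := sqrt (INR n + 1)).
  assert (Hq : 0 < q) by (now apply sqrt_lt_R0).
  assert (Hqq : q * q = INR n + 1) by (apply sqrt_sqrt; lra).
  assert (E := coin_by_parts n h); rewrite S_INR in E.
  (* The inequality |x| <= x^2 / (2 q) + q / 2 replaces Cauchy-Schwarz; with [q] the standard
     deviation both halves have the same mean. *)
  set (bd := fun i => B * (/ (2 * q) * (INR n + 1 - 2 * INR i) ^ 2 + q / 2)).
  assert (Hbd : forall i, Rabs ((INR n + 1 - 2 * INR i) * h i) <= bd i).
  { intros i; rewrite Rabs_mult, Rmult_comm; unfold bd.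
    apply Rmult_le_compat; auto using Rabs_pos.
    set (x := INR n + 1 - 2 * INR i).
    rewrite <- (pow2_abs x); set (y := Rabs x).
    replace (/ (2 * q) * y ^ 2 + q / 2) with (y + (y - q) ^ 2 / (2 * q)) by (field; lra).
    assert (0 <= (y - q) ^ 2 / (2 * q)); [|lra].
    apply Rdiv_le_0_compat; [apply pow2_ge_0 | lra]. }
  assert (Hc : coin (S n) bd = B * q).
  { unfold bd; rewrite coin_scal, coin_plus, coin_scal, coin_const, coin_variance, S_INR.
    rewrite <- Hqq; field; lra. }
  assert (Hle : Rabs (coin (S n) (fun i => (INR n + 1 - 2 * INR i) * h i)) <= B * q).
  { rewrite <- Hc; apply Rabs_le; split.
    - replace (- coin (S n) bd) with (coin (S n) (fun i => (-1) * bd i))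
        by (rewrite coin_scal; ring).
      apply coin_le; intros i; assert (A' := Rle_abs (- ((INR n + 1 - 2 * INR i) * h i))).
      rewrite Rabs_Ropp in A'; specialize (Hbd i); lra.
    - apply coin_le; intros i; eapply Rle_trans; [apply Rle_abs | apply Hbd]. }
  apply Rmult_le_reg_l with (INR n + 1); auto.
  rewrite <- (Rabs_pos_eq (INR n + 1)) at 1 by lra.
  rewrite <- Rabs_mult, E, Rabs_mult, (Rabs_pos_eq 2) by lra.
  replace ((INR n + 1) * (2 * B / q)) with (2 * (B * q)) by (rewrite <- Hqq; field; lra).
  lra.
Qed.

Definition zscale (i : nat) (w : pt) : pt := ((Z.of_nat i * fst w)%Z, (Z.of_nat i * snd w)%Z).

Lemma iter_half_coin n w f z :
  Nat.iter n (act (half w)) f z = coin n (fun i => f (zsub z (zscale i w))).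
Proof.
  revert z; induction n as [|n IH]; intros z.
  - simpl; unfold zscale, zsub; simpl; rewrite !Z.sub_0_r; now destruct z.
  - change (act (half w) (Nat.iter n (act (half w)) f) z = coin (S n) (fun i => f (zsub z (zscale i w)))).
    cbn [coin]; rewrite half_eq, !IH; do 2 f_equal.
    apply coin_ext; intros i; f_equal; unfold zsub, zscale; cbn [fst snd]; rewrite Nat2Z.inj_succ; f_equal; ring.
Qed.

Lemma grad_half_bound n w f B z : (forall x, Rabs (f x) <= B) ->
  Rabs (act (grad w) (Nat.iter n (act (half w)) f) z) <= 2 * B / sqrt (INR n + 1).
Proof.
  intros H; rewrite grad_eq, !iter_half_coin.
  rewrite (coin_ext n (fun i => f (zsub (zsub z w) (zscale i w)))
     (fun i => f (zsub z (zscale (S i) w)))).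
  - apply (coin_diff_bound n (fun i => f (zsub z (zscale i w)))); auto.
  - intros i; f_equal; unfold zsub, zscale; cbn [fst snd]; rewrite Nat2Z.inj_succ; f_equal; ring.
Qed.

(** Induction step of [grad_iter_bound]: a unit gained with probability [c] counts at least as a
    certain gain of c / 2. The lost half pays for convexity: over c / 2 the function 1 / sqrt x
    drops by at most c / (4 x^(3/2)), over a full unit by at least 1 / (4 x^(3/2)) once x >= 1. *)
Lemma inv_sqrt_supersolution c x : 0 <= c <= 1 -> 1 <= x ->
  (1 - c) / sqrt x + c / sqrt (x + 1) <= 1 / sqrt (x + c / 2).
Proof.
  intros Hc Hx.
  assert (Hp : 0 < sqrt x) by (apply sqrt_lt_R0; lra).
  assert (Hq : 0 < sqrt (x + 1)) by (apply sqrt_lt_R0; lra).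
  assert (Hr : 0 < sqrt (x + c / 2)) by (apply sqrt_lt_R0; lra).
  assert (Hpp := sqrt_sqrt x ltac:(lra)).
  assert (Hqq := sqrt_sqrt (x + 1) ltac:(lra)).
  assert (Hrr := sqrt_sqrt (x + c / 2) ltac:(lra)).
  assert (Hpr : sqrt x <= sqrt (x + c / 2)) by (apply sqrt_le_1; lra).
  assert (Hpq : sqrt x <= sqrt (x + 1)) by (apply sqrt_le_1; lra).
  set (p := sqrt x) in *; set (q := sqrt (x + 1)) in *; set (r := sqrt (x + c / 2)) in *.
  assert (A : 1 / p - 1 / r <= c / (4 * (p * p * p))).
  { replace (1 / p - 1 / r) with ((r * r - p * p) / (p * r * (r + p))) by (field; lra).
    replace (r * r - p * p) with (c / 2) by lra.
    replace (c / (4 * (p * p * p))) with ((c / 2) * / (2 * (p * p * p))) by (field; lra).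
    unfold Rdiv at 1.
    apply Rmult_le_compat_l; [lra|].
    apply Rinv_le_contravar; [repeat apply Rmult_lt_0_compat; lra|].
    replace (2 * (p * p * p)) with (p * p * (p + p)) by ring.
    apply Rmult_le_compat; nra. }
  assert (B : 1 / (4 * (p * p * p)) <= 1 / p - 1 / q).
  { replace (1 / p - 1 / q) with ((q * q - p * p) / (p * q * (q + p))) by (field; lra).
    replace (q * q - p * p) with 1 by lra.
    apply Rmult_le_compat_l; [lra|].
    apply Rinv_le_contravar; [repeat apply Rmult_lt_0_compat; lra|].
    apply Rle_trans with (p * (q * (q + q))).
    { rewrite Rmult_assoc; do 2 (apply Rmult_le_compat_l; [lra|]); lra. }
    replace (p * (q * (q + q))) with (2 * p * (q * q)) by ring.
    replace (4 * (p * p * p)) with (2 * p * (2 * (p * p))) by ring.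
    rewrite Hpp, Hqq.
    apply Rmult_le_compat_l; lra. }
  assert (C : c / (4 * (p * p * p)) <= c * (1 / p - 1 / q)).
  { replace (c / (4 * (p * p * p))) with (c * (1 / (4 * (p * p * p)))) by (field; lra).
    apply Rmult_le_compat_l; lra. }
  unfold Rdiv in *; lra.
Qed.

(** A fair toss between [v] and [v'] of mass [Rmin c1 c2] is split off from [mu]; what remains is
    still nonnegative and has mass [1 - Rmin c1 c2]. *)
Lemma act_two_atoms mu v v' c1 c2 h a b z :
  prob mu -> In (c1, v) mu -> In (c2, v') mu -> v <> v' ->
  (forall x, Rabs (h x) <= a) ->
  (forall x, Rabs (act (half (zsub v' v)) h x) <= b) ->
  Rabs (act mu h z) <= (1 - Rmin c1 c2) * a + Rmin c1 c2 * b.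
Proof.
  intros [Hpos H1] I1 I2 Hne Ha Hb.
  destruct (in_split _ _ I1) as (l1 & l2 & E); subst mu.
  assert (I2' : In (c2, v') (l1 ++ l2)).
  { apply in_app_iff in I2; apply in_app_iff; simpl in I2.
    destruct I2 as [?|[E|?]]; auto; injection E; congruence. }
  destruct (in_split _ _ I2') as (l3 & l4 & E).
  unfold act; rewrite lsum_split, E, lsum_split.
  rewrite lsum_split, E, lsum_split in H1; simpl in H1.
  assert (Hrest : Rabs (lsum (fun cw => fst cw * h (zsub z (snd cw))) (l3 ++ l4))
                  <= lsum fst (l3 ++ l4) * a).
  { eapply Rle_trans; [apply lsum_abs|].
    rewrite Rmult_comm, <- lsum_scal; apply lsum_le; intros cw Hcw.
    assert (0 <= fst cw).
    { apply Hpos. assert (In cw (l1 ++ l2)).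
      { rewrite E; apply in_app_iff; apply in_app_iff in Hcw; simpl; tauto. }
      apply in_app_iff; apply in_app_iff in H; simpl; tauto. }
    rewrite Rabs_mult, (Rabs_pos_eq (fst cw)), Rmult_comm by auto.
    apply Rmult_le_compat_r; auto. }
  set (S := lsum (fun cw => fst cw * h (zsub z (snd cw))) (l3 ++ l4)) in *.
  simpl fst; simpl snd.
  assert (Hh := Hb (zsub z v)); rewrite half_eq in Hh.
  replace (zsub (zsub z v) (zsub v' v)) with (zsub z v') in Hh
    by (unfold zsub; simpl; f_equal; ring).
  set (c := Rmin c1 c2).
  assert (Hc1 : c <= c1) by apply Rmin_l.
  assert (Hc2 : c <= c2) by apply Rmin_r.
  assert (Hc : 0 <= c).
  { apply Rmin_glb; [apply (Hpos _ I1) | apply (Hpos _ I2)]. }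
  set (x := h (zsub z v)) in *; set (y := h (zsub z v')) in *.
  assert (Hx : Rabs x <= a) by apply Ha; assert (Hy : Rabs y <= a) by apply Ha.
  replace (c1 * x + (c2 * y + S)) with
    (((c1 - c / 2) * x + (c2 - c / 2) * y) + S + c * ((x + y) / 2)) by field.
  eapply Rle_trans; [apply Rabs_triang|]; apply Rplus_le_compat.
  - eapply Rle_trans; [apply Rabs_triang|].
    apply Rle_trans with ((c1 - c / 2) * a + (c2 - c / 2) * a + lsum fst (l3 ++ l4) * a);
      [|apply Req_le; replace 1 with (c1 + (c2 + lsum fst (l3 ++ l4))) by exact H1; field].
    apply Rplus_le_compat; auto.
    eapply Rle_trans; [apply Rabs_triang|].
    rewrite !Rabs_mult, (Rabs_pos_eq (c1 - c / 2)), (Rabs_pos_eq (c2 - c / 2)) by lra.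
    apply Rplus_le_compat; apply Rmult_le_compat_l; lra.
  - rewrite Rabs_mult, (Rabs_pos_eq c) by auto; now apply Rmult_le_compat_l.
Qed.

(** Each step of [mu] hides, with weight [c], a fair toss between [v] and [v']. After k steps the
    number of tosses is of order c k, and the binomial estimate applies along v' - v. *)
Lemma grad_iter_bound mu v v' c1 c2 :
  prob mu -> In (c1, v) mu -> In (c2, v') mu -> v <> v' -> 0 < c1 -> 0 < c2 ->
  exists C, 0 <= C /\ forall f B k z, (forall x, Rabs (f x) <= B) ->
    Rabs (act (grad (zsub v' v)) (Nat.iter k (act mu) f) z) <= C * B / sqrt (INR k + 1).
Proof.
  intros Hmu I1 I2 Hne P1 P2.
  set (c := Rmin c1 c2); set (w := zsub v' v).
  assert (Hc : 0 < c) by (now apply Rmin_glb_lt).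
  assert (Hc1 : c <= 1).
  { apply Rle_trans with c1; [apply Rmin_l|].
    destruct Hmu as [Hpos <-]; apply (lsum_ge_elem fst mu (c1, v)); auto. }
  (* The induction on [k] keeps the number [i] of tosses already split off arbitrary, because one
     step of [mu] leads to a mixture of [i] and [i + 1]. *)
  assert (Main : forall f B, (forall x, Rabs (f x) <= B) -> forall k i z,
    Rabs (act (grad w) (Nat.iter i (act (half w)) (Nat.iter k (act mu) f)) z)
      <= 2 * B / sqrt (INR i + 1 + c / 2 * INR k)).
  { intros f B HB.
    assert (B0 : 0 <= B) by (eapply Rle_trans; [apply Rabs_pos | apply (HB (0,0)%Z)]).
    induction k as [|k IH]; intros i z.
    - change (INR 0) with 0; rewrite Rmult_0_r, Rplus_0_r; now apply grad_half_bound.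
    - change (Nat.iter (S k) (act mu) f) with (act mu (Nat.iter k (act mu) f)).
      rewrite <- act_iter_comm, act_comm.
      eapply Rle_trans.
      + eapply (act_two_atoms mu v v' c1 c2 _ _ _ z Hmu I1 I2 Hne (IH i)).
        intros x; fold w.
        rewrite act_comm.
        apply (IH (S i)).
      + fold c; rewrite !S_INR.
        assert (Hi := pos_INR i); assert (Hk := pos_INR k).
        set (y := INR i + 1 + c / 2 * INR k).
        assert (Hy : 1 <= y) by (unfold y; nra).
        replace (INR i + 1 + 1 + c / 2 * INR k) with (y + 1) by (unfold y; ring).
        replace (INR i + 1 + c / 2 * (INR k + 1)) with (y + c / 2) by (unfold y; field).
        assert (A := inv_sqrt_supersolution c y ltac:(lra) Hy).
        replace ((1 - c) * (2 * B / sqrt y) + c * (2 * B / sqrt (y + 1))) with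
          (2 * B * ((1 - c) / sqrt y + c / sqrt (y + 1))) by (unfold Rdiv; ring).
        replace (2 * B / sqrt (y + c / 2)) with (2 * B * (1 / sqrt (y + c / 2)))
          by (unfold Rdiv; ring).
        apply Rmult_le_compat_l; lra. }
  set (s := sqrt (c / 2)).
  assert (Hs : 0 < s) by (apply sqrt_lt_R0; lra).
  exists (2 / s); split; [apply Rdiv_le_0_compat; lra|].
  intros f B k z HB.
  assert (B0 : 0 <= B) by (eapply Rle_trans; [apply Rabs_pos | apply (HB (0,0)%Z)]).
  assert (Hk := pos_INR k).
  eapply Rle_trans; [apply (Main f B HB k O z)|].
  assert (0 < sqrt (INR k + 1)) by (apply sqrt_lt_R0; lra).
  replace (2 / s * B / sqrt (INR k + 1)) with (2 * B * / (s * sqrt (INR k + 1))) by (field; lra).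
  apply Rmult_le_compat_l; [lra|].
  apply Rinv_le_contravar; [nra|].
  unfold s; rewrite <- sqrt_mult by lra.
  change (INR 0) with 0; apply sqrt_le_1; nra.
Qed.

(** * Rapidly decaying functions modulo iterated discrete derivatives *)

Definition wt (z : pt) : R := 1 + Rabs (IZR (fst z)) + Rabs (IZR (snd z)).

Lemma wt_ge1 z : 1 <= wt z.
Proof.
  unfold wt; assert (A := Rabs_pos (IZR (fst z))); assert (B := Rabs_pos (IZR (snd z))); lra.
Qed.

Lemma wt_pos z : 0 < wt z.
Proof. assert (A := wt_ge1 z); lra. Qed.

Lemma wt_pow_pos z N : 0 < wt z ^ N.
Proof. apply pow_lt, wt_pos. Qed.

Lemma wt_sub z v : wt z <= wt (zsub z v) + wt v - 1.
Proof.
  unfold wt, zsub; simpl; rewrite !minus_IZR.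
  assert (A := Rabs_triang (IZR (fst z) - IZR (fst v)) (IZR (fst v))).
  assert (B := Rabs_triang (IZR (snd z) - IZR (snd v)) (IZR (snd v))).
  replace (IZR (fst z) - IZR (fst v) + IZR (fst v)) with (IZR (fst z)) in A by ring.
  replace (IZR (snd z) - IZR (snd v) + IZR (snd v)) with (IZR (snd z)) in B by ring.
  lra.
Qed.

Lemma wt_sub_mult z v : wt z <= wt (zsub z v) * wt v.
Proof.
  assert (A := wt_sub z v); assert (B := wt_ge1 (zsub z v)); assert (C := wt_ge1 v); nra.
Qed.

Definition Decay (N : nat) (f : pt -> R) : Prop := exists C, forall z, Rabs (f z) <= C / wt z ^ N.

Lemma Decay_cst_nonneg N f C : (forall z : pt, Rabs (f z) <= C / wt z ^ N) -> 0 <= C.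
Proof.
  intros H; specialize (H (0, 0)%Z).
  assert (A := Rabs_pos (f (0, 0)%Z)); assert (B := wt_pow_pos (0, 0)%Z N).
  destruct (Rle_or_lt 0 C) as [|HC]; auto.
  assert (C / wt (0, 0)%Z ^ N < 0); [|lra].
  apply Rmult_lt_reg_r with (wt (0, 0)%Z ^ N); auto; unfold Rdiv.
  rewrite Rmult_assoc, Rinv_l; lra.
Qed.

Lemma Decay_le N N' f : (N' <= N)%nat -> Decay N f -> Decay N' f.
Proof.
  intros HN [C HC]; assert (C0 := Decay_cst_nonneg _ _ _ HC); exists C; intros z.
  eapply Rle_trans; [apply HC|].
  apply Rmult_le_compat_l; auto; apply Rinv_le_contravar; [apply wt_pow_pos|].
  apply Rle_pow; auto using wt_ge1.
Qed.

Lemma Decay_zero N : Decay N (fun _ => 0).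
Proof. exists 0; intros z; rewrite Rabs_R0; unfold Rdiv; lra. Qed.

Lemma Decay_plus N f g : Decay N f -> Decay N g -> Decay N (fun z => f z + g z).
Proof.
  intros [C HC] [C' HC']; exists (C + C'); intros z.
  eapply Rle_trans; [apply Rabs_triang|].
  specialize (HC z); specialize (HC' z); unfold Rdiv in *; lra.
Qed.

Lemma Decay_scal N c f : Decay N f -> Decay N (fun z => c * f z).
Proof.
  intros [C HC]; exists (Rabs c * C); intros z; rewrite Rabs_mult.
  unfold Rdiv; rewrite Rmult_assoc; apply Rmult_le_compat_l; [apply Rabs_pos | apply HC].
Qed.

Lemma Decay_shift N f v : Decay N f -> Decay N (fun z => f (zsub z v)).
Proof.
  intros [C HC]; assert (C0 := Decay_cst_nonneg _ _ _ HC); exists (C * wt v ^ N); intros z.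
  eapply Rle_trans; [apply HC|].
  assert (A := wt_pow_pos z N); assert (B := wt_pow_pos (zsub z v) N).
  assert (E : wt z ^ N <= wt (zsub z v) ^ N * wt v ^ N).
  { rewrite <- Rpow_mult_distr; apply pow_incr; split; [apply Rlt_le, wt_pos | apply wt_sub_mult]. }
  unfold Rdiv; rewrite Rmult_assoc; apply Rmult_le_compat_l; auto.
  apply Rmult_le_reg_l with (wt (zsub z v) ^ N); auto.
  rewrite Rinv_r by lra.
  apply Rmult_le_reg_r with (wt z ^ N); auto.
  replace (wt (zsub z v) ^ N * (wt v ^ N * / wt z ^ N) * wt z ^ N)
    with (wt (zsub z v) ^ N * wt v ^ N) by (field; lra); lra.
Qed.

Lemma Decay_act N mu f : Decay N f -> Decay N (act mu f).
Proof.
  intros H; induction mu as [|[c w] mu IH].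
  - apply Decay_zero.
  - rewrite act_cons; apply Decay_plus; auto; now apply Decay_scal, (Decay_shift N f w).
Qed.

Definition e1 : pt := (1, 0)%Z.
Definition e2 : pt := (0, 1)%Z.

(** [N] is the decay of the potentials being differenced, [m] the number of differences. With N = 0
    the potentials are merely bounded, which is what the heat flow estimate asks for. *)
Fixpoint Diff (N m : nat) (f : pt -> R) : Prop :=
  match m with
  | O => Decay N f
  | S m' => exists f1 f2, Diff N m' f1 /\ Diff N m' f2 /\
      f = fun z => act (grad e1) f1 z + act (grad e2) f2 z
  end.

Lemma Diff_le N N' m : (N' <= N)%nat -> forall f, Diff N m f -> Diff N' m f.
Proof.
  intros HN; induction m as [|m IH]; simpl; intros f; [now apply Decay_le|].
  intros (f1 & f2 & H1 & H2 & ->); exists f1, f2; auto.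
Qed.

Lemma Diff_plus N m : forall f g, Diff N m f -> Diff N m g -> Diff N m (fun z => f z + g z).
Proof.
  induction m as [|m IH]; simpl; intros f g; [apply Decay_plus|].
  intros (f1 & f2 & H1 & H2 & ->) (g1 & g2 & H3 & H4 & ->).
  exists (fun z => f1 z + g1 z), (fun z => f2 z + g2 z).
  split; [now apply IH|]; split; [now apply IH|].
  rewrite !act_plus; extensionality z; ring.
Qed.

Lemma Diff_act N m mu : forall f, Diff N m f -> Diff N m (act mu f).
Proof.
  induction m as [|m IH]; simpl; intros f; [apply Decay_act|].
  intros (f1 & f2 & H1 & H2 & ->).
  exists (act mu f1), (act mu f2); repeat split; auto.
  rewrite act_plus, !(act_comm (grad _) mu); reflexivity.
Qed.

Lemma Diff_scal N m c f : Diff N m f -> Diff N m (fun z => c * f z).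
Proof.
  intros H; assert (A := Diff_act N m ((c, (0, 0)%Z) :: nil) f H).
  replace (fun z => c * f z) with (act ((c, (0, 0)%Z) :: nil) f); auto.
  extensionality z; unfold act; simpl; rewrite zsub_0_r; ring.
Qed.

Lemma Diff_zero N m : Diff N m (fun _ => 0).
Proof.
  induction m as [|m IH]; simpl; [apply Decay_zero|].
  exists (fun _ => 0), (fun _ => 0); repeat split; auto.
  extensionality z; rewrite !grad_eq; ring.
Qed.

Lemma Diff_Decay N m : forall f, Diff N m f -> Decay N f.
Proof.
  induction m as [|m IH]; simpl; intros f; auto.
  intros (f1 & f2 & H1 & H2 & ->); apply Decay_plus; apply Decay_act; auto.
Qed.

Lemma Diff_grad1 N m f : Diff N m f -> Diff N (S m) (act (grad e1) f).
Proof.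
  intros H; exists f, (fun _ => 0); repeat split; auto using Diff_zero.
  extensionality z; rewrite (grad_eq e2); ring.
Qed.

Lemma Diff_grad2 N m f : Diff N m f -> Diff N (S m) (act (grad e2) f).
Proof.
  intros H; exists (fun _ => 0), f; repeat split; auto using Diff_zero.
  extensionality z; rewrite (grad_eq e1); ring.
Qed.

(** * Summation along columns *)

Lemma ex_series_inv_sq : ex_series (fun j => / (INR j + 1) ^ 2).
Proof.
  apply (ex_series_le (K := R_AbsRing) (V := R_CompleteNormedModule))
    with (fun j => 2 * (/ (INR j + 1) - / (INR j + 2))).
  - intros j; change (norm (/ (INR j + 1) ^ 2)) with (Rabs (/ (INR j + 1) ^ 2)).
    assert (A := pos_INR j).
    rewrite Rabs_pos_eq by (apply Rlt_le, Rinv_0_lt_compat, pow_lt; lra).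
    replace (2 * (/ (INR j + 1) - / (INR j + 2))) with (/ ((INR j + 1) * ((INR j + 2) / 2)))
      by (field; lra).
    apply Rinv_le_contravar; [apply Rmult_lt_0_compat; lra|]; nra.
  - exists 2.
    apply (is_lim_seq_ext (fun n => 2 - 2 * / (INR n + 2)) _ 2).
    + intros n; induction n as [|n IH].
      * rewrite sum_O; simpl; field.
      * rewrite sum_Sn, <- IH, S_INR; unfold plus; simpl.
        assert (A := pos_INR n); field; lra.
    + replace (Finite 2) with (Finite (2 - 2 * 0)) by (f_equal; ring).
      apply is_lim_seq_minus'; [apply is_lim_seq_const|].
      apply (is_lim_seq_scal_l _ 2 0).
      replace (Finite 0) with (Rbar_inv p_infty) by reflexivity.
      apply is_lim_seq_inv; [|discriminate].
      apply (is_lim_seq_le_p_loc INR); [|apply is_lim_seq_INR].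
      exists O; intros; lra.
Qed.

Lemma series_inv_sq_bound a M : (forall j : nat, Rabs (a j) <= M * / (INR j + 1) ^ 2) ->
  ex_series a /\ Rabs (Series a) <= M * Series (fun j => / (INR j + 1) ^ 2).
Proof.
  intros H.
  assert (E : ex_series (fun j => M * / (INR j + 1) ^ 2))
    by (apply (ex_series_scal (K := R_AbsRing) (V := R_NormedModule) M (fun j => / (INR j + 1) ^ 2)),
        ex_series_inv_sq).
  assert (EA : ex_series (fun j => Rabs (a j))).
  { apply (ex_series_le (K := R_AbsRing) (V := R_CompleteNormedModule))
      with (fun j => M * / (INR j + 1) ^ 2); auto.
    intros j; change (Rabs (Rabs (a j)) <= M * / (INR j + 1) ^ 2); now rewrite Rabs_Rabsolu. }
  split; [now apply ex_series_Rabs|].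
  eapply Rle_trans; [now apply Series_Rabs|].
  rewrite <- Series_scal_l; apply Series_le; auto.
  intros j; split; auto using Rabs_pos.
Qed.

(** Two powers of decay pay for a factor summable in [j]; the other [N] survive the summation. *)
Lemma wt_tail_bound C N W j : 0 <= C -> 1 <= W ->
  C / (W + INR j) ^ (N + 2) <= C / W ^ N * / (INR j + 1) ^ 2.
Proof.
  intros HC HW; assert (A := pos_INR j); unfold Rdiv; rewrite Rmult_assoc.
  apply Rmult_le_compat_l; auto.
  rewrite <- Rinv_mult, pow_add.
  apply Rinv_le_contravar; [apply Rmult_lt_0_compat; apply pow_lt; lra|].
  apply Rmult_le_compat; try (apply pow_le; lra); apply pow_incr; lra.
Qed.

Definition colsum (f : pt -> R) (m : Z) : R :=
  Series (fun j => f (m, (-1 - Z.of_nat j)%Z)) + Series (fun j => f (m, Z.of_nat j)).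

(** Antiderivative of [f] along a column, summed from the infinite end on the same side so that it
    decays in both directions. The price is paid between rows -1 and 0, where its difference misses
    [f] by the column sum. *)
Definition coltail (f : pt -> R) (z : pt) : R :=
  if (snd z <? 0)%Z then Series (fun j => f (fst z, (snd z - Z.of_nat j)%Z))
  else - Series (fun j => f (fst z, (snd z + 1 + Z.of_nat j)%Z)).

Lemma col_series N f C z (s : nat -> Z) : (forall z, Rabs (f z) <= C / wt z ^ (N + 2)) ->
  (forall j, wt z + INR j <= wt (fst z, s j)) ->
  ex_series (fun j => f (fst z, s j)) /\
  Rabs (Series (fun j => f (fst z, s j))) <=
    C * Series (fun j => / (INR j + 1) ^ 2) / wt z ^ N.
Proof.
  intros HC Hs; assert (C0 := Decay_cst_nonneg _ _ _ HC).
  replace (C * Series (fun j => / (INR j + 1) ^ 2) / wt z ^ N) with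
    (C / wt z ^ N * Series (fun j => / (INR j + 1) ^ 2)) by (unfold Rdiv; ring).
  apply series_inv_sq_bound; intros j.
  eapply Rle_trans; [apply HC|].
  eapply Rle_trans; [|apply wt_tail_bound; auto using wt_ge1].
  apply Rmult_le_compat_l; auto.
  assert (A := wt_pos z); assert (B := pos_INR j).
  apply Rinv_le_contravar; [apply pow_lt; lra|].
  apply pow_incr; split; [lra | apply Hs].
Qed.

Lemma wt_below z j : (snd z <= 0)%Z -> wt z + INR j <= wt (fst z, (snd z - Z.of_nat j)%Z).
Proof.
  intros H; unfold wt; simpl; rewrite minus_IZR, <- INR_IZR_INZ.
  apply IZR_le in H; assert (A := pos_INR j).
  rewrite (Rabs_left1 (IZR (snd z))), (Rabs_left1 (IZR (snd z) - INR j)); lra.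
Qed.

Lemma wt_above z j : (0 <= snd z)%Z -> wt z + INR j <= wt (fst z, (snd z + Z.of_nat j)%Z).
Proof.
  intros H; unfold wt; simpl; rewrite plus_IZR, <- INR_IZR_INZ.
  apply IZR_le in H; assert (A := pos_INR j).
  rewrite (Rabs_pos_eq (IZR (snd z))), (Rabs_pos_eq (IZR (snd z) + INR j)); lra.
Qed.

Lemma col_ex_below N f m n : Decay (N + 2) f -> (n <= 0)%Z ->
  ex_series (fun j => f (m, (n - Z.of_nat j)%Z)).
Proof.
  intros [C HC] Hn; apply (col_series N f C (m, n) (fun j => (n - Z.of_nat j)%Z) HC).
  intros j; now apply (wt_below (m, n)).
Qed.

Lemma col_ex_above N f m n : Decay (N + 2) f -> (0 <= n)%Z ->
  ex_series (fun j => f (m, (n + Z.of_nat j)%Z)).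
Proof.
  intros [C HC] Hn; apply (col_series N f C (m, n) (fun j => (n + Z.of_nat j)%Z) HC).
  intros j; now apply (wt_above (m, n)).
Qed.

Lemma coltail_Decay N f : Decay (N + 2) f -> Decay N (coltail f).
Proof.
  intros [C HC]; exists (C * Series (fun j => / (INR j + 1) ^ 2)); intros z.
  unfold coltail; destruct (Z.ltb_spec (snd z) 0) as [H|H].
  - apply (col_series N f C z (fun j => (snd z - Z.of_nat j)%Z) HC).
    intros j; apply wt_below; lia.
  - rewrite Rabs_Ropp; apply (col_series N f C z (fun j => (snd z + 1 + Z.of_nat j)%Z) HC).
    intros j; apply Rle_trans with (wt z + INR (S j)); [rewrite S_INR; lra|].
    eapply Rle_trans; [apply (wt_above z (S j) H)|].
    rewrite Nat2Z.inj_succ; apply Req_le; do 2 f_equal; lia.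
Qed.

Lemma colsum_bound N f : Decay (N + 2) f ->
  Decay N (fun z => if (snd z =? 0)%Z then colsum f (fst z) else 0).
Proof.
  intros [C HC]; set (S2 := Series (fun j => / (INR j + 1) ^ 2)).
  assert (C0 := Decay_cst_nonneg _ _ _ HC).
  assert (HS : 0 <= C * S2 + C * S2).
  { assert (A := proj2 (col_series N f C (0, 0)%Z Z.of_nat HC
       (fun j => wt_above (0, 0)%Z j (Z.le_refl 0)))).
    fold S2 in A.
    assert (0 <= C * S2); [|lra].
    assert (B := Rabs_pos (Series (fun j => f (fst (0, 0)%Z, Z.of_nat j)))).
    assert (E := wt_pow_pos (0, 0)%Z N).
    apply Rmult_le_reg_r with (/ wt (0, 0)%Z ^ N); [now apply Rinv_0_lt_compat|].
    rewrite Rmult_0_l; eapply Rle_trans; [exact B | exact A]. }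
  exists (C * S2 + C * S2); intros z.
  destruct (Z.eqb_spec (snd z) 0) as [H|H].
  - unfold colsum; eapply Rle_trans; [apply Rabs_triang|].
    unfold Rdiv; rewrite Rmult_plus_distr_r; apply Rplus_le_compat.
    + apply (col_series N f C z (fun j => (-1 - Z.of_nat j)%Z) HC).
      intros j; eapply Rle_trans; [|apply (Req_le (wt (fst z, (snd z - Z.of_nat (S j))%Z)))].
      * eapply Rle_trans; [|apply wt_below; lia]; rewrite S_INR; lra.
      * rewrite H, Nat2Z.inj_succ; do 2 f_equal; lia.
    + apply (col_series N f C z Z.of_nat HC).
      intros j; eapply Rle_trans; [apply wt_above; lia | rewrite H; apply Rle_refl].
  - rewrite Rabs_R0; apply Rdiv_le_0_compat; [auto | apply wt_pow_pos].
Qed.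

Lemma column_split N f z : Decay (N + 2) f ->
  f z = (if (snd z =? 0)%Z then colsum f (fst z) else 0) + act (grad e2) (coltail f) z.
Proof.
  intros HD; destruct z as [m n]; rewrite grad_eq.
  unfold coltail, colsum, zsub, e2; cbn [fst snd]; rewrite Z.sub_0_r.
  assert (Hb := fun k => col_ex_below N f m k HD).
  assert (Ha := fun k => col_ex_above N f m k HD).
  assert (ext : forall s t : nat -> Z, (forall j, s j = t j) ->
     Series (fun j => f (m, s j)) = Series (fun j => f (m, t j)))
    by (intros s t H; apply Series_ext; intros j; now rewrite H).
  destruct (Z.ltb_spec n 0) as [H|H].
  - destruct (Z.eqb_spec n 0) as [H'|_]; [lia|].
    destruct (Z.ltb_spec (n - 1) 0) as [_|H']; [|lia].
    rewrite (Series_incr_1 (fun j => f (m, (n - Z.of_nat j)%Z))) by (apply Hb; lia).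
    rewrite (ext (fun j => (n - Z.of_nat (S j))%Z) (fun j => (n - 1 - Z.of_nat j)%Z))
      by (intros; lia).
    change (Z.of_nat 0) with 0%Z; rewrite Z.sub_0_r; ring.
  - destruct (Z.eqb_spec n 0) as [->|H0].
    + change (0 - 1 <? 0)%Z with true; change (0 =? 0)%Z with true; cbv iota.
      rewrite (ext (fun j => (0 - 1 - Z.of_nat j)%Z) (fun j => (-1 - Z.of_nat j)%Z))
        by (intros; lia).
      rewrite (Series_incr_1 (fun j => f (m, Z.of_nat j)))
        by (apply (Ha 0%Z); lia).
      rewrite (ext (fun j => Z.of_nat (S j)) (fun j => (0 + 1 + Z.of_nat j)%Z))
        by (intros; lia).
      change (Z.of_nat 0) with 0%Z; ring.
    + destruct (Z.ltb_spec (n - 1) 0) as [H'|_]; [lia|].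
      rewrite (ext (fun j => (n - 1 + 1 + Z.of_nat j)%Z) (fun j => (n + Z.of_nat j)%Z))
        by (intros; lia).
      rewrite (Series_incr_1 (fun j => f (m, (n + Z.of_nat j)%Z))) by (apply Ha; lia).
      rewrite (ext (fun j => (n + Z.of_nat (S j))%Z) (fun j => (n + 1 + Z.of_nat j)%Z))
        by (intros; lia).
      change (Z.of_nat 0) with 0%Z; rewrite Z.add_0_r; ring.
Qed.

Definition swap (z : pt) : pt := (snd z, fst z).

Lemma Decay_swap N f : Decay N f -> Decay N (fun z => f (swap z)).
Proof.
  intros [C HC]; exists C; intros z.
  replace (wt z) with (wt (swap z)) by (unfold wt, swap; simpl; ring); apply HC.
Qed.

(** Column summation pushes [f] onto row 0 modulo a difference in [e2]; the same with coordinates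
    exchanged pushes that row onto the origin. Each summation costs two powers, and [s] is the total
    mass of [f]. *)
Lemma Decay_split N f : Decay (N + 4) f -> exists s, Diff N 1 (fun z => f z - s * delta z).
Proof.
  intros Hf; replace (N + 4)%nat with (N + 2 + 2)%nat in Hf by lia.
  set (r := fun z : pt => if (snd z =? 0)%Z then colsum f (fst z) else 0).
  assert (Hr : Decay (N + 2) (fun z => r (swap z))) by now apply Decay_swap, colsum_bound.
  set (r' := fun z => r (swap z)) in Hr.
  exists (colsum r' 0), (fun z => coltail r' (swap z)), (coltail f); repeat split.
  - apply (Decay_swap N (coltail r')), coltail_Decay; auto.
  - apply (Decay_le (N + 2)); [lia | now apply coltail_Decay].
  - extensionality z; rewrite (column_split (N + 2) f z Hf); fold (r z).
    assert (E := column_split N r' (swap z) Hr).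
    replace (r' (swap z)) with (r z) in E by (unfold r', swap; now destruct z).
    rewrite grad_eq in E; rewrite E.
    rewrite !grad_eq.
    replace (swap (zsub z e1)) with (zsub (swap z) e2)
      by (unfold swap, zsub, e1, e2; reflexivity).
    (* [r'] lives on column 0, so its other column sums vanish. *)
    assert (E0 : (if (snd (swap z) =? 0)%Z then colsum r' (fst (swap z)) else 0)
                 = colsum r' 0 * delta z).
    { unfold delta; destruct z as [m n]; unfold swap; cbn [fst snd].
      destruct (m =? 0)%Z; simpl; [|ring].
      destruct (Z.eqb_spec n 0) as [->|Hn]; simpl; [ring|].
      unfold colsum.
      assert (Ez : forall k, r' (n, k) = 0).
      { intros k; unfold r', r, swap; simpl; now destruct (Z.eqb_spec n 0). }
      rewrite (Series_ext _ (fun _ => 0)) by (intros; apply Ez).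
      rewrite (Series_ext (fun j => r' (n, Z.of_nat j)) (fun _ => 0)) by (intros; apply Ez).
      rewrite (Series_ext (fun _ => 0) (fun _ => 0 * 0)) by (intros; ring).
      rewrite Series_scal_l; ring. }
    rewrite E0; ring.
Qed.

(** Modulo a difference, a decaying function is s delta and delta is c g, which settles m = 0. For
    higher [m] the potentials are corrected first, and the corrections are differenced along with
    them. *)
Lemma Diff_lift_step N c g : Diff N 1 (fun z => delta z - c * g z) ->
  forall m f, Diff (N + 4) m f -> exists nu, Diff N (S m) (fun z => f z - act nu g z).
Proof.
  intros Hg; induction m as [|m IH]; intros f Hf.
  - destruct (Decay_split N f Hf) as [s Hs].
    exists ((s * c, (0, 0)%Z) :: nil).
    replace (fun z => f z - act ((s * c, (0, 0)%Z) :: nil) g z) with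
      (fun z => (f z - s * delta z) + s * (delta z - c * g z)).
    + apply Diff_plus; auto; now apply (Diff_scal N 1).
    + extensionality z; unfold act; simpl; rewrite zsub_0_r; ring.
  - destruct Hf as (f1 & f2 & H1 & H2 & ->).
    destruct (IH f1 H1) as [nu1 A1]; destruct (IH f2 H2) as [nu2 A2].
    (* Convolution of [nu] with [grad w] written as a list: [nu] minus its translate by [w]. *)
    set (push := fun w (nu : list (R * pt)) =>
      nu ++ map (fun cv => (- fst cv, (fst (snd cv) + fst w, snd (snd cv) + snd w)%Z)) nu).
    assert (push_eq : forall w nu, act (push w nu) g = act (grad w) (act nu g)).
    { intros w nu; unfold push; rewrite act_app; extensionality z; rewrite grad_eq.
      unfold Rminus; f_equal; unfold act; rewrite lsum_map; cbn [fst snd].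
      replace (- lsum (fun cw => fst cw * g (zsub (zsub z w) (snd cw))) nu)
        with (-1 * lsum (fun cw => fst cw * g (zsub (zsub z w) (snd cw))) nu) by ring.
      rewrite <- lsum_scal; apply lsum_ext; intros [d v] _; cbn [fst snd].
      replace (zsub z (fst v + fst w, snd v + snd w)%Z) with (zsub (zsub z w) v);
        [ring | unfold zsub; cbn [fst snd]; f_equal; ring]. }
    exists (push e1 nu1 ++ push e2 nu2).
    exists (fun z => f1 z - act nu1 g z), (fun z => f2 z - act nu2 g z).
    repeat split; auto.
    rewrite act_app, !push_eq, !act_minus; extensionality z; ring.
Qed.

(** [Decay_split] consumes four powers at each of the [m] levels, hence the 4 m. *)
Lemma Diff_lift c g m : forall N f, Decay (N + 4 * m) f ->
  Diff (N + 4 * m) 1 (fun z => delta z - c * g z) ->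
  exists nu, Diff N m (fun z => f z - act nu g z).
Proof.
  induction m as [|m IH]; intros N f Hf Hg.
  - exists nil; replace (N + 4 * 0)%nat with N in * by lia.
    replace (fun z => f z - act nil g z) with f; auto.
    extensionality z; unfold act; simpl; ring.
  - replace (N + 4 * S m)%nat with (N + 4 + 4 * m)%nat in * by lia.
    destruct (IH (N + 4)%nat f Hf Hg) as [nu Hnu].
    destruct (Diff_lift_step N c g) with (2 := Hnu) as [nu' Hnu'].
    + eapply Diff_le; [|exact Hg]; lia.
    + exists (nu ++ nu'); rewrite act_app.
      replace (fun z => f z - (act nu g z + act nu' g z)) with
        (fun z => f z - act nu g z - act nu' g z) by (extensionality z; ring); auto.
Qed.

(** The mixed difference of the indicator of a quadrant is a point mass at its corner. *)
Lemma delta_Diff_0_2 : Diff 0 2 delta.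
Proof.
  set (q := fun z : pt => if ((0 <=? fst z)%Z && (0 <=? snd z)%Z)%bool then 1 else 0).
  replace delta with (act (grad e1) (act (grad e2) q)).
  - apply Diff_grad1, Diff_grad2; exists 1; intros z; unfold q; simpl.
    destruct (_ && _)%bool; rewrite ?Rabs_R1, ?Rabs_R0; lra.
  - extensionality z; rewrite !grad_eq; destruct z as [m n].
    unfold q, delta, zsub, e1, e2; cbn [fst snd].
    destruct (Z.leb_spec 0 m), (Z.leb_spec 0 n), (Z.leb_spec 0 (m - 1)),
      (Z.leb_spec 0 (n - 1)), (Z.leb_spec 0 (m - 0)), (Z.leb_spec 0 (n - 0)),
      (Z.leb_spec 0 (m - 1 - 0)), (Z.leb_spec 0 (n - 0 - 1)),
      (Z.eqb_spec m 0), (Z.eqb_spec n 0); try lia; simpl; ring.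
Qed.

(* Because [delta] is itself a second difference of a bounded function, so is every
   decaying function: this yields the two-dimensional heat kernel bound [1/n]. *)
Lemma Decay_Diff_0_2 f : Decay 8 f -> Diff 0 2 f.
Proof.
  intros Hf; destruct (Diff_lift 1 delta 2 0 f Hf) as [nu Hnu].
  - replace (fun z => delta z - 1 * delta z) with (fun _ : pt => 0);
      [apply Diff_zero | extensionality z; ring].
  - replace f with (fun z => (f z - act nu delta z) + act nu delta z)
      by (extensionality z; ring).
    apply Diff_plus; auto; apply Diff_act, delta_Diff_0_2.
Qed.

(** * Decay under the heat flow *)

(** Uniformity over all bounded [f] lets the estimate be applied again to whatever earlier time
    steps have produced, once for each difference. Such directions are closed under addition
    ([smoothing_add]). *)
Definition smoothing (mu : list (R * pt)) (w : pt) : Prop :=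
  exists C, 0 <= C /\ forall f B k z, (forall x, Rabs (f x) <= B) ->
    Rabs (act (grad w) (Nat.iter k (act mu) f) z) <= C * B / sqrt (INR k + 1).

(** The time [n] contains [m] blocks of length [k]; each block uses up one difference in exchange
    for a factor 1 / sqrt(k + 1). *)
Lemma iter_decay mu : prob mu -> smoothing mu e1 -> smoothing mu e2 ->
  forall m f, Diff 0 m f -> exists C, 0 <= C /\ forall k n z, (m * k <= n)%nat ->
    Rabs (Nat.iter n (act mu) f z) <= C / sqrt (INR k + 1) ^ m.
Proof.
  intros Hmu [G1 [HG1 S1]] [G2 [HG2 S2]]; induction m as [|m IH]; intros f Hf.
  - destruct Hf as [C HC]; assert (C0 := Decay_cst_nonneg _ _ _ HC).
    exists C; split; auto; intros k n z _.
    apply iter_contract; auto; intros x; specialize (HC x); simpl in *; auto.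
  - destruct Hf as (f1 & f2 & H1 & H2 & ->).
    destruct (IH f1 H1) as (C1 & P1 & B1); destruct (IH f2 H2) as (C2 & P2 & B2).
    exists (G1 * C1 + G2 * C2); split.
    { apply Rplus_le_le_0_compat; now apply Rmult_le_pos. }
    intros k n z Hn.
    assert (Hp : 0 < sqrt (INR k + 1)) by (apply sqrt_lt_R0; assert (A := pos_INR k); lra).
    rewrite iter_plus, <- !act_iter_comm.
    replace n with (k + (n - k))%nat by nia.
    rewrite !Nat.iter_add.
    assert (Hn' : (m * k <= n - k)%nat) by nia.
    assert (X1 := S1 _ _ k z (fun x => B1 k (n - k)%nat x Hn')).
    assert (X2 := S2 _ _ k z (fun x => B2 k (n - k)%nat x Hn')).
    eapply Rle_trans; [apply Rabs_triang|].
    replace ((G1 * C1 + G2 * C2) / sqrt (INR k + 1) ^ S m) with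
      (G1 * (C1 / sqrt (INR k + 1) ^ m) / sqrt (INR k + 1) +
       G2 * (C2 / sqrt (INR k + 1) ^ m) / sqrt (INR k + 1)); [lra|].
    assert (0 < sqrt (INR k + 1) ^ m) by now apply pow_lt.
    simpl; field; split; lra.
Qed.

(** Finite propagation speed: [n] steps move by at most L n, so values of [f] nearer to the origin
    than wt z - L n are never seen. *)
Lemma iter_local mu n f : prob mu -> forall L, 0 <= L ->
  (forall cw, In cw mu -> wt (snd cw) - 1 <= L) ->
  forall z B, (forall x, wt z - L * INR n <= wt x -> Rabs (f x) <= B) ->
  Rabs (Nat.iter n (act mu) f z) <= B.
Proof.
  intros Hmu L HL HR; induction n as [|n IH]; intros z B H.
  - apply H; simpl; lra.
  - change (Rabs (act mu (Nat.iter n (act mu) f) z) <= B).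
    apply act_contract; auto; intros cw Hcw; apply IH; intros x Hx; apply H.
    specialize (HR cw Hcw); assert (A := wt_sub z (snd cw)); rewrite S_INR; lra.
Qed.

(** * Asymptotic expansions in [z] and [1 / conj z] *)

Open Scope C_scope.

(* [zeta z = 1 / conj z], so that [mono a b z = z^(a+b) / |z|^(2b)]. *)
Definition zeta (z : C) : C := z * RtoC (/ Cmod z ^ 2).

Definition mono (a b : nat) (z : C) : C := z ^ a * zeta z ^ b.

Lemma nz_of_Cmod (z : C) : (0 < Cmod z)%R -> z <> 0.
Proof. apply Cmod_gt_0. Qed.

Lemma zeta_conj (z : C) : z <> 0 -> zeta z * Cconj z = 1.
Proof.
  intros Hz; unfold zeta; apply (proj1 (Cmod_gt_0 z)) in Hz.
  assert (0 < Cmod z ^ 2)%R by now apply pow_lt.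
  replace (z * RtoC (/ Cmod z ^ 2) * Cconj z) with (RtoC (/ Cmod z ^ 2) * (z * Cconj z)) by ring.
  rewrite <- Cmod2_conj, <- RtoC_mult, Rinv_l by lra; reflexivity.
Qed.

Lemma Cconj_nz (z : C) : z <> 0 -> Cconj z <> 0.
Proof. intros H; apply Cmod_gt_0; rewrite Cmod_conj; now apply (proj1 (Cmod_gt_0 z)). Qed.

Lemma zeta_inv (z : C) : z <> 0 -> zeta z = / Cconj z.
Proof.
  intros Hz; assert (H := zeta_conj z Hz); assert (Hc := Cconj_nz z Hz).
  rewrite <- (Cmult_1_l (/ Cconj z)), <- H; field; auto.
Qed.

Lemma Cmod_zeta (z : C) : z <> 0 -> Cmod (zeta z) = (/ Cmod z)%R.
Proof. intros Hz; rewrite zeta_inv, Cmod_inv, Cmod_conj; auto using Cconj_nz. Qed.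

(** Resolvent identity for 1 / (conj z - conj w); iterating it produces the geometric series with an
    exact remainder. *)
Lemma zeta_shift_eq (z w : C) : z <> 0 -> z - w <> 0 ->
  zeta (z - w) = zeta z + Cconj w * zeta z * zeta (z - w).
Proof.
  intros H1 H2; rewrite !zeta_inv by auto.
  assert (A := Cconj_nz _ H1); assert (B := Cconj_nz _ H2).
  rewrite Cminus_conj in *; field; auto.
Qed.

Lemma mono_mul a b a' b' (z : C) : mono a b z * mono a' b' z = mono (a + a') (b + b') z.
Proof. unfold mono; rewrite !Cpow_add_r; ring. Qed.

Lemma Cmod_mono a b (z : C) : z <> 0 -> Cmod (mono a b z) = (Cmod z ^ a / Cmod z ^ b)%R.
Proof.
  intros Hz; unfold mono; rewrite Cmod_mult, !Cmod_pow, Cmod_zeta, pow_inv by auto.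
  reflexivity.
Qed.

Lemma mono_expansion a b (z : C) : z <> 0 ->
  mono a b z = cpow z (a + b) * RtoC (/ Cmod z ^ (2 * b)).
Proof.
  intros Hz; apply (proj1 (Cmod_gt_0 z)) in Hz.
  assert (E : forall n, cpow z n = z ^ n) by (induction n as [|n IH]; simpl; congruence).
  rewrite E; unfold mono, zeta; rewrite Cpow_mult_l, Cpow_add_r, <- RtoC_pow, pow_inv, <- pow_mult.
  ring.
Qed.

(** * Order symbols and asymptotic expansions *)

Definition bigO (N : nat) (F : C -> C) : Prop :=
  exists B M : R, (1 <= M)%R /\ forall z, (M <= Cmod z)%R -> (Cmod (F z) <= B / Cmod z ^ N)%R.

Definition grow (q : nat) (F : C -> C) : Prop :=
  exists B M : R, (1 <= M)%R /\ forall z, (M <= Cmod z)%R -> (Cmod (F z) <= B * Cmod z ^ q)%R.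

Definition ev_eq (F G : C -> C) : Prop :=
  exists M : R, forall z, (M <= Cmod z)%R -> F z = G z.

Lemma bigO_ext N F G : ev_eq F G -> bigO N F -> bigO N G.
Proof.
  intros [M' HM] (B & M & H1 & H); exists B, (Rmax M M'); split.
  - eapply Rle_trans; [exact H1 | apply Rmax_l].
  - intros z Hz; rewrite <- HM; [apply H|]; eapply Rle_trans; try exact Hz;
      [apply Rmax_l | apply Rmax_r].
Qed.

Lemma bigO_le N N' F : (N' <= N)%nat -> bigO N F -> bigO N' F.
Proof.
  intros HN (B & M & H1 & H); exists (Rabs B), M; split; auto; intros z Hz.
  eapply Rle_trans; [apply H; auto|].
  assert (0 < Cmod z ^ N)%R by (apply pow_lt; lra).
  eapply Rle_trans; [apply Rmult_le_compat_r; [apply Rlt_le, Rinv_0_lt_compat; auto | apply Rle_abs]|].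
  apply Rmult_le_compat_l; [apply Rabs_pos|].
  apply Rinv_le_contravar; [apply pow_lt; lra | apply Rle_pow; auto; lra].
Qed.

Lemma bigO_plus N F G : bigO N F -> bigO N G -> bigO N (fun z => F z + G z).
Proof.
  intros (B & M & H1 & H) (B' & M' & H1' & H'); exists (B + B')%R, (Rmax M M'); split.
  - eapply Rle_trans; [exact H1 | apply Rmax_l].
  - intros z Hz; eapply Rle_trans; [apply Cmod_triangle|].
    unfold Rdiv; rewrite Rmult_plus_distr_r; apply Rplus_le_compat; [apply H | apply H'];
      eapply Rle_trans; try exact Hz; [apply Rmax_l | apply Rmax_r].
Qed.

Lemma bigO_mul q N F G : grow q F -> bigO (N + q) G -> bigO N (fun z => F z * G z).
Proof.
  intros (B & M & H1 & H) (B' & M' & H1' & H'); exists (Rabs B * Rabs B')%R, (Rmax M M'); split.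
  - eapply Rle_trans; [exact H1 | apply Rmax_l].
  - intros z Hz.
    assert (Hz1 : (M <= Cmod z)%R) by (eapply Rle_trans; try exact Hz; apply Rmax_l).
    assert (Hz2 : (M' <= Cmod z)%R) by (eapply Rle_trans; try exact Hz; apply Rmax_r).
    assert (Pq : (0 < Cmod z ^ q)%R) by (apply pow_lt; lra).
    assert (PN : (0 < Cmod z ^ N)%R) by (apply pow_lt; lra).
    rewrite Cmod_mult.
    specialize (H z Hz1); specialize (H' z Hz2); rewrite pow_add in H'.
    apply Rle_trans with ((Rabs B * Cmod z ^ q) * (Rabs B' / (Cmod z ^ N * Cmod z ^ q)))%R.
    + apply Rmult_le_compat; try apply Cmod_ge_0.
      * eapply Rle_trans; [exact H|]; apply Rmult_le_compat_r; [lra | apply Rle_abs].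
      * eapply Rle_trans; [exact H'|]; apply Rmult_le_compat_r;
          [apply Rlt_le, Rinv_0_lt_compat; nra | apply Rle_abs].
    + apply Req_le; field; lra.
Qed.

Lemma grow_const c : grow 0 (fun _ => c).
Proof. exists (Cmod c), 1%R; split; [lra|]; intros; simpl; lra. Qed.

Lemma bigO_scal N c F : bigO N F -> bigO N (fun z => c * F z).
Proof.
  intros H; apply (bigO_mul 0 N (fun _ => c)); [apply grow_const|].
  now rewrite Nat.add_0_r.
Qed.

Lemma grow_le q q' F : (q <= q')%nat -> grow q F -> grow q' F.
Proof.
  intros Hq (B & M & H1 & H); exists (Rabs B), M; split; auto; intros z Hz.
  eapply Rle_trans; [apply H; auto|].
  assert (0 < Cmod z ^ q)%R by (apply pow_lt; lra).
  apply Rle_trans with (Rabs B * Cmod z ^ q)%R.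
  - apply Rmult_le_compat_r; [lra | apply Rle_abs].
  - apply Rmult_le_compat_l; [apply Rabs_pos | apply Rle_pow; auto; lra].
Qed.

Lemma grow_plus q F G : grow q F -> grow q G -> grow q (fun z => F z + G z).
Proof.
  intros (B & M & H1 & H) (B' & M' & H1' & H'); exists (B + B')%R, (Rmax M M'); split.
  - eapply Rle_trans; [exact H1 | apply Rmax_l].
  - intros z Hz; eapply Rle_trans; [apply Cmod_triangle|].
    rewrite Rmult_plus_distr_r; apply Rplus_le_compat; [apply H | apply H'];
      eapply Rle_trans; try exact Hz; [apply Rmax_l | apply Rmax_r].
Qed.

Lemma bigO_grow q F : bigO 0 F -> grow q F.
Proof.
  intros (B & M & H1 & H); apply (grow_le 0); [lia|].
  exists B, M; split; auto; intros z Hz; specialize (H z Hz); simpl in *; unfold Rdiv in *.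
  rewrite Rinv_1 in H; auto.
Qed.

(* Span of the monomials [z^a (1/conj z)^b] of homogeneity degree [a - b <= -d]. *)
Inductive Span (d : Z) : (C -> C) -> Prop :=
| Span_nil : Span d (fun _ => RtoC 0)
| Span_cons c a b P : (Z.of_nat a + d <= Z.of_nat b)%Z -> Span d P ->
    Span d (fun z => c * mono a b z + P z).

Lemma Span_le d d' P : (d' <= d)%Z -> Span d P -> Span d' P.
Proof.
  intros Hd; induction 1; [constructor|]; apply Span_cons; auto; lia.
Qed.

Lemma Span_plus d P Q : Span d P -> Span d Q -> Span d (fun z => P z + Q z).
Proof.
  intros HP HQ; induction HP as [|c a b P Hab HP IH].
  - replace (fun z => 0 + Q z) with Q; auto; extensionality z; ring.
  - replace (fun z => c * mono a b z + P z + Q z) with (fun z => c * mono a b z + (P z + Q z))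
      by (extensionality z; ring).
    now constructor.
Qed.

Lemma Span_scal d c P : Span d P -> Span d (fun z => c * P z).
Proof.
  induction 1 as [|c' a b P Hab HP IH].
  - replace (fun _ : C => c * 0) with (fun _ : C => RtoC 0); [constructor|].
    extensionality z; ring.
  - replace (fun z => c * (c' * mono a b z + P z)) with (fun z => (c * c') * mono a b z + c * P z)
      by (extensionality z; ring).
    now constructor.
Qed.

(** The alternative c = 0 copes with truncated subtraction: an exponent such as [a - 2] at a < 2
    gives a monomial of the wrong degree, but then its coefficient is zero. *)
Lemma Span_term d (c : C) a b : c = 0 \/ (Z.of_nat a + d <= Z.of_nat b)%Z ->
  Span d (fun z => c * mono a b z).
Proof.
  intros [-> | H].
  - replace (fun z => 0 * mono a b z) with (fun _ : C => RtoC 0); [constructor|].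
    extensionality z; ring.
  - replace (fun z => c * mono a b z) with (fun z => c * mono a b z + 0);
      [repeat constructor; auto | extensionality z; ring].
Qed.

Lemma Span_mono d a b : (Z.of_nat a + d <= Z.of_nat b)%Z -> Span d (mono a b).
Proof.
  intros H; replace (mono a b) with (fun z => 1 * mono a b z) by (extensionality z; ring).
  apply Span_term; auto.
Qed.

Lemma Span_mul d d' P Q : Span d P -> Span d' Q -> Span (d + d') (fun z => P z * Q z).
Proof.
  intros HP HQ; induction HP as [|c a b P Hab HP IH].
  - replace (fun z => 0 * Q z) with (fun _ : C => RtoC 0); [constructor|].
    extensionality z; ring.
  - replace (fun z => (c * mono a b z + P z) * Q z) with
      (fun z => c * (mono a b z * Q z) + P z * Q z) by (extensionality z; ring).
    apply Span_plus; auto; apply Span_scal; clear IH HP P.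
    induction HQ as [|c' a' b' Q Hab' HQ IH].
    + replace (fun z => mono a b z * 0) with (fun _ : C => RtoC 0); [constructor|].
      extensionality z; ring.
    + replace (fun z => mono a b z * (c' * mono a' b' z + Q z)) with
        (fun z => c' * mono (a + a') (b + b') z + mono a b z * Q z).
      * constructor; auto; lia.
      * extensionality z; rewrite <- mono_mul; ring.
Qed.

Lemma Span_grow d P : Span d P -> grow (Z.to_nat (- d)) P.
Proof.
  induction 1 as [|c a b P Hab HP IH].
  - apply (grow_le 0); [lia | apply grow_const].
  - apply grow_plus; auto.
    exists (Cmod c), 1%R; split; [lra|]; intros z Hz.
    assert (Hz0 : (0 < Cmod z)%R) by lra.
    rewrite Cmod_mult, Cmod_mono by now apply nz_of_Cmod.
    apply Rmult_le_compat_l; [apply Cmod_ge_0|].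
    assert (0 < Cmod z ^ b)%R by now apply pow_lt.
    apply Rmult_le_reg_r with (Cmod z ^ b)%R; auto.
    unfold Rdiv; rewrite Rmult_assoc, Rinv_l, Rmult_1_r, <- pow_add by lra.
    apply Rle_pow; auto; lia.
Qed.

Lemma Span_bigO N P : Span (Z.of_nat N) P -> bigO N P.
Proof.
  induction 1 as [|c a b P Hab HP IH].
  - exists 0%R, 1%R; split; [lra|]; intros; rewrite Cmod_0; unfold Rdiv; lra.
  - apply bigO_plus; auto.
    exists (Cmod c), 1%R; split; [lra|]; intros z Hz.
    assert (Hz0 : (0 < Cmod z)%R) by lra.
    rewrite Cmod_mult, Cmod_mono by now apply nz_of_Cmod.
    apply Rmult_le_compat_l; [apply Cmod_ge_0|].
    assert (0 < Cmod z ^ b)%R by now apply pow_lt.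
    assert (0 < Cmod z ^ N)%R by now apply pow_lt.
    apply Rmult_le_reg_r with (Cmod z ^ b)%R; auto.
    unfold Rdiv; rewrite Rmult_assoc, Rinv_l, Rmult_1_r by lra.
    apply Rmult_le_reg_l with (Cmod z ^ N)%R; auto.
    rewrite <- Rmult_assoc, Rinv_r, Rmult_1_l, <- pow_add by lra.
    apply Rle_pow; auto; lia.
Qed.

(** An expansion to every order, with leading order |z|^-d; the spans chosen for different [N] need
    not be related. *)
Definition Exp (d : Z) (F : C -> C) : Prop :=
  forall N, exists P, Span d P /\ bigO N (fun z => F z - P z).

Lemma Exp_ext d F G : ev_eq F G -> Exp d F -> Exp d G.
Proof.
  intros [M HM] H N; destruct (H N) as (P & HP & HO); exists P; split; auto.
  eapply bigO_ext; [|exact HO]; exists M; intros z Hz; now rewrite HM.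
Qed.

Lemma Exp_le d d' F : (d' <= d)%Z -> Exp d F -> Exp d' F.
Proof.
  intros Hd H N; destruct (H N) as (P & HP & HO); exists P; split; auto.
  eapply Span_le; eauto.
Qed.

Lemma Exp_Span d P : Span d P -> Exp d P.
Proof.
  intros H N; exists P; split; auto.
  exists 0%R, 1%R; split; [lra|]; intros z Hz.
  replace (P z - P z) with (RtoC 0) by ring; rewrite Cmod_0; unfold Rdiv; lra.
Qed.

Lemma Exp_plus d F G : Exp d F -> Exp d G -> Exp d (fun z => F z + G z).
Proof.
  intros HF HG N; destruct (HF N) as (P & HP & HPO); destruct (HG N) as (Q & HQ & HQO).
  exists (fun z => P z + Q z); split; [now apply Span_plus|].
  replace (fun z => F z + G z - (P z + Q z)) with (fun z => (F z - P z) + (G z - Q z))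
    by (extensionality z; ring).
  now apply bigO_plus.
Qed.

Lemma Exp_scal d c F : Exp d F -> Exp d (fun z => c * F z).
Proof.
  intros HF N; destruct (HF N) as (P & HP & HPO).
  exists (fun z => c * P z); split; [now apply Span_scal|].
  replace (fun z => c * F z - c * P z) with (fun z => c * (F z - P z)) by (extensionality z; ring).
  now apply bigO_scal.
Qed.

Lemma Exp_grow d F : Exp d F -> grow (Z.to_nat (- d)) F.
Proof.
  intros HF; destruct (HF O) as (P & HP & HPO).
  replace F with (fun z => P z + (F z - P z)) by (extensionality z; ring).
  apply grow_plus; [now apply Span_grow | now apply bigO_grow].
Qed.

Lemma Exp_mul d d' F G : Exp d F -> Exp d' G -> Exp (d + d') (fun z => F z * G z).
Proof.
  intros HF HG N.
  destruct (HF (N + Z.to_nat (- d'))%nat) as (P & HP & HPO).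
  destruct (HG (N + Z.to_nat (- d))%nat) as (Q & HQ & HQO).
  exists (fun z => P z * Q z); split; [now apply Span_mul|].
  replace (fun z => F z * G z - P z * Q z) with
    (fun z => G z * (F z - P z) + P z * (G z - Q z)) by (extensionality z; ring).
  apply bigO_plus.
  - apply (bigO_mul (Z.to_nat (- d'))); auto; now apply Exp_grow.
  - apply (bigO_mul (Z.to_nat (- d))); auto; now apply Span_grow.
Qed.

Lemma large_shift_nz (w z : C) : (Cmod w + 1 <= Cmod z)%R -> z <> 0 /\ z - w <> 0.
Proof.
  intros H; assert (A := Cmod_ge_0 w); split; apply nz_of_Cmod; [lra|].
  assert (B := Cmod_triangle (z - w) w).
  replace (z - w + w) with z in B by ring; lra.
Qed.

Lemma Cmod_zeta_shift_le (w z : C) : (2 * Cmod w + 1 <= Cmod z)%R ->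
  (Cmod (zeta (z - w)) <= 2 / Cmod z)%R.
Proof.
  intros H; assert (A := Cmod_ge_0 w).
  destruct (large_shift_nz w z) as [Hz Hzw]; [lra|].
  rewrite Cmod_zeta by auto.
  assert (B := Cmod_triangle (z - w) w).
  replace (z - w + w) with z in B by ring.
  replace (2 / Cmod z)%R with (/ (Cmod z / 2))%R by (field; lra).
  apply Rinv_le_contravar; lra.
Qed.

(** The approximants obey P_(N+1) = zeta + conj w zeta P_N. By the resolvent identity the error gets
    multiplied by conj w zeta and so gains one power of |z|. *)
Lemma Exp_zeta_shift w : Exp 1 (fun z => zeta (z - w)).
Proof.
  assert (H : forall N, exists P, Span 1 P /\ bigO (S N) (fun z => zeta (z - w) - P z)).
  { induction N as [|N (P & HP & HO)].
    - exists (fun _ => RtoC 0); split; [constructor|].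
      exists 2%R, (2 * Cmod w + 1)%R; split; [assert (A := Cmod_ge_0 w); lra|].
      intros z Hz; replace (zeta (z - w) - 0) with (zeta (z - w)) by ring.
      rewrite pow_1; now apply Cmod_zeta_shift_le.
    - exists (fun z => mono 0 1 z + Cconj w * (mono 0 1 z * P z)); split.
      + apply Span_plus; [apply Span_mono; lia|].
        apply Span_scal, (Span_le (1 + 1)); [lia|].
        apply Span_mul; auto; apply Span_mono; lia.
      + apply bigO_ext with
          (fun z => Cconj w * (mono 0 1 z * (zeta (z - w) - P z))).
        * exists (Cmod w + 1)%R; intros z Hz; destruct (large_shift_nz w z Hz) as [Hz0 Hz1].
          transitivity (zeta z + Cconj w * zeta z * zeta (z - w)
                        - (mono 0 1 z + Cconj w * (mono 0 1 z * P z))).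
          -- unfold mono; simpl; ring.
          -- now rewrite <- zeta_shift_eq.
        * apply bigO_scal.
          destruct HO as (B & M & H1 & H); exists B, M; split; auto; intros z Hz.
          rewrite Cmod_mult, Cmod_mono by (apply nz_of_Cmod; lra).
          assert (0 < Cmod z ^ S N)%R by (apply pow_lt; lra).
          replace (B / Cmod z ^ S (S N))%R with (Cmod z ^ 0 / Cmod z ^ 1 * (B / Cmod z ^ S N))%R
            by (cbn [pow] in *; field; split; [nra | lra] || (field; nra)).
          apply Rmult_le_compat_l; auto; simpl; apply Rdiv_le_0_compat; lra. }
  intros N; destruct (H N) as (P & HP & HO); exists P; split; auto.
  eapply bigO_le; [|exact HO]; lia.
Qed.

Lemma Exp_zeta_shift_pow w b : Exp (Z.of_nat b) (fun z => zeta (z - w) ^ b).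
Proof.
  induction b as [|b IH].
  - apply Exp_ext with (mono 0 0); [exists 0%R; intros; unfold mono; simpl; ring|].
    apply Exp_Span, Span_mono; lia.
  - apply (Exp_le (1 + Z.of_nat b)); [lia|].
    apply (Exp_mul 1 (Z.of_nat b) (fun z => zeta (z - w))); auto; apply Exp_zeta_shift.
Qed.

Lemma Exp_zeta_shift2 w :
  Exp 4 (fun z => zeta (z - w) -
    (mono 0 1 z + Cconj w * mono 0 2 z + Cconj w ^ 2 * mono 0 3 z)).
Proof.
  apply Exp_ext with (fun z => (Cconj w ^ 3 * mono 0 3 z) * zeta (z - w)).
  - exists (Cmod w + 1)%R; intros z Hz; destruct (large_shift_nz w z Hz) as [Hz0 Hz1].
    assert (E := zeta_shift_eq z w Hz0 Hz1); unfold mono; simpl.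
    set (q := zeta z) in *; set (r := zeta (z - w)) in *; set (v := Cconj w) in *.
    transitivity ((q + v * q * (q + v * q * (q + v * q * r))) -
      (1 * (q * 1) + v * (1 * (q * (q * 1))) + v * (v * 1) * (1 * (q * (q * (q * 1)))))); [ring|].
    now rewrite <- !E.
  - apply (Exp_mul 3 1 (fun z => Cconj w ^ 3 * mono 0 3 z)); [|apply Exp_zeta_shift].
    apply Exp_Span, Span_scal, Span_mono; lia.
Qed.

(** The coefficients of x^2 in (1 - x)^(-b) and in (1 - x)^a. The second vanishes at a = 0 and a =
    1, where [a - 2] is truncated. *)
Definition rise2 (b : nat) : C := RtoC (INR b * (INR b + 1) / 2).
Definition fall2 (a : nat) : C := RtoC (INR a * (INR a - 1) / 2).

Definition zeta_pow2 (w : C) (b : nat) (z : C) : C :=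
  mono 0 b z + RtoC (INR b) * Cconj w * mono 0 (b + 1) z
  + rise2 b * Cconj w ^ 2 * mono 0 (b + 2) z.

Definition z_pow2 (w : C) (a : nat) (z : C) : C :=
  mono a 0 z - RtoC (INR a) * w * mono (a - 1) 0 z + fall2 a * w ^ 2 * mono (a - 2) 0 z.

Lemma Exp_zeta_pow2 w b :
  Exp (Z.of_nat b + 3) (fun z => zeta (z - w) ^ b - zeta_pow2 w b z).
Proof.
  induction b as [|b IH].
  - apply Exp_ext with (fun _ => RtoC 0); [|apply Exp_Span; constructor].
    exists 0%R; intros z _; unfold zeta_pow2, rise2, mono; simpl INR.
    replace (0 * (0 + 1) / 2)%R with 0%R by field; simpl; ring.
  - set (T1 := fun z => mono 0 1 z + Cconj w * mono 0 2 z + Cconj w ^ 2 * mono 0 3 z).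
    assert (HT1 : Span 1 T1).
    { apply Span_plus; [apply Span_plus|]; [apply Span_mono; lia | |];
        apply Span_scal, Span_mono; lia. }
    apply Exp_ext with (fun z =>
      ((zeta (z - w) - T1 z) * zeta (z - w) ^ b + T1 z * (zeta (z - w) ^ b - zeta_pow2 w b z))
      + (((rise2 b + RtoC (INR b)) * Cconj w ^ 3) * mono 0 (b + 4) z
         + (rise2 b * Cconj w ^ 4) * mono 0 (b + 5) z)).
    + exists 0%R; intros z _.
      assert (E : rise2 (S b) = rise2 b + RtoC (INR b) + 1).
      { unfold rise2; rewrite <- !RtoC_plus; f_equal; rewrite S_INR; field. }
      unfold zeta_pow2; rewrite E, S_INR, RtoC_plus.
      unfold T1, mono; rewrite Cpow_S, !Cpow_add_r; cbn [Nat.add]; rewrite ?Cpow_S.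
      rewrite ?Cpow_add_r, ?Cpow_S.
      set (q := zeta z); set (r := zeta (z - w)); set (v := Cconj w).
      simpl; ring.
    + apply Exp_plus; [apply Exp_plus|].
      * apply (Exp_le (4 + Z.of_nat b)); [lia|].
        apply (Exp_mul 4 (Z.of_nat b) (fun z => zeta (z - w) - T1 z));
          [apply Exp_zeta_shift2 | apply Exp_zeta_shift_pow].
      * apply (Exp_le (1 + (Z.of_nat b + 3))); [lia|].
        apply (Exp_mul 1 (Z.of_nat b + 3) T1); auto; now apply Exp_Span.
      * apply Exp_Span, Span_plus; apply Span_scal, Span_mono; lia.
Qed.

Lemma Exp_z_shift w : Exp (-1) (fun z => z - w).
Proof.
  apply Exp_ext with (fun z => mono 1 0 z + (- w) * mono 0 0 z).
  - exists 0%R; intros z _; unfold mono; simpl; ring.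
  - apply Exp_Span, Span_plus; [|apply Span_scal]; apply Span_mono; lia.
Qed.

Lemma Exp_z_pow2 w a :
  Exp (3 - Z.of_nat a) (fun z => (z - w) ^ a - z_pow2 w a z).
Proof.
  induction a as [|a IH].
  - apply Exp_ext with (fun _ => RtoC 0); [|apply Exp_Span; constructor].
    exists 0%R; intros z _; unfold z_pow2, fall2, mono; simpl INR.
    replace (0 * (0 - 1) / 2)%R with 0%R by field; simpl; ring.
  - assert (E : fall2 (S a) = fall2 a + RtoC (INR a)).
    { unfold fall2; rewrite <- !RtoC_plus; f_equal; rewrite S_INR; field. }
    apply Exp_ext with (fun z =>
      (z - w) * ((z - w) ^ a - z_pow2 w a z) + (- (fall2 a * w ^ 3)) * mono (a - 2) 0 z).
    + exists 0%R; intros z _; unfold z_pow2; rewrite E, S_INR, RtoC_plus, Cpow_S.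
      unfold mono; destruct a as [|[|a]].
      * unfold fall2; simpl INR; replace (0 * (0 - 1) / 2)%R with 0%R by field; simpl; ring.
      * unfold fall2; simpl INR; replace (1 * (1 - 1) / 2)%R with 0%R by field; simpl; ring.
      * replace (S (S a) - 2)%nat with a by lia; replace (S (S a) - 1)%nat with (S a) by lia.
        replace (S (S (S a)) - 2)%nat with (S a) by lia.
        replace (S (S (S a)) - 1)%nat with (S (S a)) by lia.
        rewrite !Cpow_S; simpl (_ ^ 0); ring.
    + apply Exp_plus.
      * apply (Exp_le (-1 + (3 - Z.of_nat a))); [lia|].
        apply (Exp_mul (-1) (3 - Z.of_nat a) (fun z => z - w)); auto; apply Exp_z_shift.
      * apply Exp_Span, Span_term.
        destruct a as [|[|a]]; [left|left|right; lia]; unfold fall2; simpl INR.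
        -- replace (0 * (0 - 1) / 2)%R with 0%R by field; ring.
        -- replace (1 * (1 - 1) / 2)%R with 0%R by field; ring.
Qed.

Lemma Span_z_pow2 w a : Span (- Z.of_nat a) (z_pow2 w a).
Proof.
  unfold z_pow2.
  replace (fun z => mono a 0 z - RtoC (INR a) * w * mono (a - 1) 0 z
                    + fall2 a * w ^ 2 * mono (a - 2) 0 z)
    with (fun z => mono a 0 z + (- (RtoC (INR a) * w)) * mono (a - 1) 0 z
                    + (fall2 a * w ^ 2) * mono (a - 2) 0 z) by (extensionality z; ring).
  apply Span_plus; [apply Span_plus|]; [|apply Span_scal|apply Span_scal]; apply Span_mono; lia.
Qed.

(* Second-order Taylor polynomial of [mono a b (z - w)] in [w], [conj w]. *)
Definition taylor2 (a b : nat) (w z : C) : C :=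
  mono a b z
  + w * (- RtoC (INR a) * mono (a - 1) b z)
  + Cconj w * (RtoC (INR b) * mono a (b + 1) z)
  + w ^ 2 * (fall2 a * mono (a - 2) b z)
  + (w * Cconj w) * (- RtoC (INR a * INR b) * mono (a - 1) (b + 1) z)
  + Cconj w ^ 2 * (rise2 b * mono a (b + 2) z).

Lemma Exp_mono_shift2 a b w :
  Exp (Z.of_nat b - Z.of_nat a + 3) (fun z => mono a b (z - w) - taylor2 a b w z).
Proof.
  apply Exp_ext with (fun z =>
    ((z - w) ^ a - z_pow2 w a z) * zeta (z - w) ^ b
    + z_pow2 w a z * (zeta (z - w) ^ b - zeta_pow2 w b z)
    + ((- (RtoC (INR a) * rise2 b * w * Cconj w ^ 2)) * mono (a - 1) (b + 2) z
       + (fall2 a * RtoC (INR b) * w ^ 2 * Cconj w) * mono (a - 2) (b + 1) z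
       + (fall2 a * rise2 b * w ^ 2 * Cconj w ^ 2) * mono (a - 2) (b + 2) z)).
  - exists 0%R; intros z _; unfold taylor2, z_pow2, zeta_pow2, mono.
    rewrite RtoC_mult; simpl (_ ^ 0); ring.
  - apply Exp_plus; [apply Exp_plus|].
    + apply (Exp_le ((3 - Z.of_nat a) + Z.of_nat b)); [lia|].
      apply (Exp_mul _ _ (fun z => (z - w) ^ a - z_pow2 w a z));
        [apply Exp_z_pow2 | apply Exp_zeta_shift_pow].
    + apply (Exp_le (- Z.of_nat a + (Z.of_nat b + 3))); [lia|].
      apply (Exp_mul _ _ (z_pow2 w a)); [apply Exp_Span, Span_z_pow2 | apply Exp_zeta_pow2].
    + assert (F0 : fall2 0 = 0)
        by (unfold fall2; simpl INR; f_equal; field).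
      assert (F1 : fall2 1 = 0)
        by (unfold fall2; simpl INR; f_equal; field).
      apply Exp_Span, Span_plus; [apply Span_plus|]; apply Span_term;
        destruct a as [|[|a]]; try (right; lia); left;
        rewrite ?F0, ?F1; simpl; ring.
Qed.

Lemma Exp_mono_shift a b w : Exp (Z.of_nat b - Z.of_nat a) (fun z => mono a b (z - w)).
Proof.
  apply (Exp_le (- Z.of_nat a + Z.of_nat b)); [lia|].
  apply (Exp_mul _ _ (fun z => (z - w) ^ a)); [|apply Exp_zeta_shift_pow].
  replace (fun z => (z - w) ^ a) with
    (fun z => z_pow2 w a z + ((z - w) ^ a - z_pow2 w a z)) by (extensionality z; ring).
  apply Exp_plus; [apply Exp_Span, Span_z_pow2|].
  eapply Exp_le; [|apply Exp_z_pow2]; lia.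
Qed.

Lemma Exp_Span_shift d P w : Span d P -> Exp d (fun z => P (z - w)).
Proof.
  induction 1 as [|c a b P Hab HP IH]; [apply Exp_Span; constructor|].
  apply Exp_plus; auto; apply Exp_scal.
  eapply Exp_le; [|apply Exp_mono_shift]; lia.
Qed.

(** * Averages over a step law with spherical second moments *)

Definition csum {A : Type} (f : A -> C) (l : list A) : C :=
  fold_right (fun a acc => f a + acc) (RtoC 0) l.

Lemma csum_ext {A} (f g : A -> C) l : (forall a, f a = g a) -> csum f l = csum g l.
Proof. intros H; induction l as [|a l IH]; simpl; [auto | now rewrite H, IH]. Qed.

Lemma csum_plus {A} (f g : A -> C) l : csum (fun a => f a + g a) l = csum f l + csum g l.
Proof. induction l as [|a l IH]; simpl; [ring | rewrite IH; ring]. Qed.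

Lemma csum_scal_r {A} (f : A -> C) c l : csum (fun a => f a * c) l = csum f l * c.
Proof. induction l as [|a l IH]; simpl; [ring | rewrite IH; ring]. Qed.

Lemma Re_csum {A} (f : A -> C) l : Re (csum f l) = lsum (fun a => Re (f a)) l.
Proof. induction l as [|a l IH]; simpl; [auto | now rewrite <- IH]. Qed.

Lemma Im_csum {A} (f : A -> C) l : Im (csum f l) = lsum (fun a => Im (f a)) l.
Proof. induction l as [|a l IH]; simpl; [auto | now rewrite <- IH]. Qed.

Lemma C_eq (x y : C) : Re x = Re y -> Im x = Im y -> x = y.
Proof. apply injective_projections. Qed.

Lemma Exp_csum {A} d (F : A -> C -> C) l : (forall a, Exp d (F a)) ->
  Exp d (fun z => csum (fun a => F a z) l).
Proof.
  intros H; induction l as [|a l IH]; simpl.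
  - apply Exp_Span; constructor.
  - now apply Exp_plus.
Qed.

Section Laplacian.

Variables (S0 : Type) (em : S0 -> C) (p : S0 -> R) (l : list S0) (sigma : R).

Definition avg (F : C -> C) (z : C) : C := csum (fun w => RtoC (p w) * F (z - em w)) l.

(* Spherical symmetry of the second moments kills every second-order term of the
   Taylor expansion except the one carrying [w * conj w]. *)
Definition spherical_moments : Prop :=
  lsum p l = 1%R /\
  csum (fun w => RtoC (p w) * em w) l = 0 /\
  csum (fun w => RtoC (p w) * Cconj (em w)) l = 0 /\
  csum (fun w => RtoC (p w) * em w ^ 2) l = 0 /\
  csum (fun w => RtoC (p w) * Cconj (em w) ^ 2) l = 0 /\
  csum (fun w => RtoC (p w) * (em w * Cconj (em w))) l = RtoC sigma.

Hypothesis Hmom : spherical_moments.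
Hypothesis Hsigma : sigma <> 0%R.

Lemma csum_p : csum (fun w => RtoC (p w)) l = 1.
Proof.
  destruct Hmom as [H _]; apply C_eq; rewrite ?Re_csum, ?Im_csum; simpl.
  - exact H.
  - rewrite (lsum_ext _ (fun w => 0 * p w)%R) by (intros; ring); rewrite lsum_scal; ring.
Qed.

Lemma avg_mono a b : Exp (Z.of_nat b - Z.of_nat a + 3) (fun z =>
  avg (mono a b) z - mono a b z
  + RtoC (INR a * INR b * sigma) * mono (a - 1) (b + 1) z).
Proof.
  assert (H : Exp (Z.of_nat b - Z.of_nat a + 3) (fun z =>
     csum (fun w => RtoC (p w) * (mono a b (z - em w) - taylor2 a b (em w) z)) l)).
  { apply (Exp_csum _ (fun w z => RtoC (p w) * (mono a b (z - em w) - taylor2 a b (em w) z))).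
    intros w; apply Exp_scal, Exp_mono_shift2. }
  eapply Exp_ext; [|exact H]; exists 0%R; intros z _; unfold avg.
  rewrite (csum_ext _ (fun w => RtoC (p w) * mono a b (z - em w) + (
     RtoC (p w) * (- mono a b z)
     + (RtoC (p w) * em w * (RtoC (INR a) * mono (a - 1) b z)
     + (RtoC (p w) * Cconj (em w) * (- RtoC (INR b) * mono a (b + 1) z)
     + (RtoC (p w) * em w ^ 2 * (- fall2 a * mono (a - 2) b z)
     + (RtoC (p w) * (em w * Cconj (em w)) * (RtoC (INR a * INR b) * mono (a - 1) (b + 1) z)
     + RtoC (p w) * Cconj (em w) ^ 2 * (- rise2 b * mono a (b + 2) z)))))))).
  2: { intros w; unfold taylor2; ring. }
  rewrite !csum_plus, !csum_scal_r, csum_p.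
  destruct Hmom as (_ & -> & -> & -> & -> & ->).
  rewrite (RtoC_mult _ sigma); ring.
Qed.

Lemma avg_plus F G z : avg (fun z => F z + G z) z = avg F z + avg G z.
Proof. unfold avg; rewrite <- csum_plus; apply csum_ext; intros; ring. Qed.

Lemma avg_scal c F z : avg (fun z => c * F z) z = c * avg F z.
Proof.
  unfold avg; rewrite Cmult_comm, <- csum_scal_r; apply csum_ext; intros; ring.
Qed.

(** A term z^a zeta^b of order at least 3 has b >= 3, so z^(a+1) zeta^(b-1) cancels it with a
    nonzero divisor. The new monomial has order b - a - 2 >= 1, and [avg_mono] leaves an error of
    order b - a + 1. *)
Lemma avg_solve d Q : (3 <= d)%Z -> Span d Q ->
  exists U, Span 1 U /\ Exp (d + 1) (fun z => avg U z - U z + Q z).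
Proof.
  intros Hd; induction 1 as [|c a b P Hab HP (U & HU & HE)].
  - exists (fun _ => RtoC 0); split; [constructor|].
    apply Exp_ext with (fun _ => RtoC 0); [|apply Exp_Span; constructor].
    exists 0%R; intros z _; unfold avg.
    rewrite csum_scal_r; ring.
  - set (k := (INR (a + 1) * INR (b - 1) * sigma)%R).
    assert (Hk : RtoC k <> 0).
    { intros E; apply RtoC_inj in E; revert E; unfold k.
      apply Rmult_integral_contrapositive_currified; auto.
      apply Rmult_integral_contrapositive_currified; apply not_0_INR; lia. }
    exists (fun z => (c / RtoC k) * mono (a + 1) (b - 1) z + U z); split.
    + constructor; auto; lia.
    + apply Exp_ext with (fun z =>
        (c / RtoC k) * (avg (mono (a + 1) (b - 1)) z - mono (a + 1) (b - 1) z
                        + RtoC k * mono (a + 1 - 1) (b - 1 + 1) z)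
        + (avg U z - U z + P z)).
      * exists 0%R; intros z _; rewrite avg_plus, avg_scal.
        replace (a + 1 - 1)%nat with a by lia; replace (b - 1 + 1)%nat with b by lia.
        field; auto.
      * apply Exp_plus; auto; apply Exp_scal.
        eapply Exp_le; [|apply avg_mono]; lia.
Qed.

(** * Expansion of the logarithm *)

(** Terms of degree 3 to J + 2 in the series of -ln (1 - u). Degrees 1 and 2 are kept apart since
    the moment conditions cancel them. *)
Fixpoint log_tail (J : nat) (u : C) : C :=
  match J with
  | O => 0
  | S J' => log_tail J' u + RtoC (/ INR (J' + 3)) * u ^ (J' + 3)
  end.

Fixpoint log_tail_deriv (J : nat) (u : C) (t : R) : R :=
  match J with
  | O => 0%R
  | S J' => (log_tail_deriv J' u t + t ^ (J' + 2) * Re (u ^ (J' + 3)))%R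
  end.

Lemma Re_scal (r : R) (u : C) : Re (RtoC r * u) = (r * Re u)%R.
Proof. unfold Re; simpl; ring. Qed.

Lemma log_tail_is_derive J u t :
  is_derive (fun t : R => Re (log_tail J (RtoC t * u))) t (log_tail_deriv J u t).
Proof.
  induction J as [|J IH].
  - apply (is_derive_const (K := R_AbsRing) (V := R_NormedModule) 0%R).
  - apply is_derive_ext with
      (fun t => (Re (log_tail J (RtoC t * u)) + / INR (J + 3) * (t ^ (J + 3) * Re (u ^ (J + 3))))%R).
    + intros s; simpl log_tail.
      rewrite Cpow_mult_l, <- RtoC_pow.
      rewrite <- (Re_scal (s ^ (J + 3))), <- (Re_scal (/ INR (J + 3))); reflexivity.
    + apply (is_derive_plus (K := R_AbsRing) (V := R_NormedModule)); auto.
      replace (J + 3)%nat with (S (J + 2)) by lia.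
      assert (Hk : INR (S (J + 2)) <> 0%R) by (apply not_0_INR; lia).
      generalize (Re (u ^ S (J + 2))); intros r.
      auto_derive; auto.
      change (/ INR (S (J + 2)) * (1 * (INR (S (J + 2)) * t ^ (J + 2)) * r) = t ^ (J + 2) * r)%R.
      field; auto.
Qed.

Lemma one_minus_nz (u : C) t : (Cmod u <= 1 / 2)%R -> (0 <= t <= 1)%R ->
  (1 / 2 <= Cmod (1 - RtoC t * u))%R.
Proof.
  intros Hu Ht.
  assert (A := Cmod_triangle (1 - RtoC t * u) (RtoC t * u)).
  replace (1 - RtoC t * u + RtoC t * u) with (RtoC 1) in A by ring.
  rewrite Cmod_1, Cmod_mult, Cmod_R, Rabs_pos_eq in A by lra.
  assert (B := Cmod_ge_0 u); nra.
Qed.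

(** Finite geometric series: along t u, the derivatives of the logarithm and of its Taylor
    polynomial cancel down to a single remainder. *)
Lemma log_tail_geometric J u t : (1 - RtoC t * u <> 0) ->
  (- Re (u / (1 - RtoC t * u)) + Re u + t * Re (u ^ 2) + log_tail_deriv J u t
   = - Re (u ^ (J + 3) * RtoC (t ^ (J + 2)) / (1 - RtoC t * u)))%R.
Proof.
  intros H; induction J as [|J IH].
  - simpl log_tail_deriv; rewrite Rplus_0_r.
    rewrite <- (Re_scal t (u ^ 2)).
    replace (u ^ (0 + 3) * RtoC (t ^ (0 + 2)) / (1 - RtoC t * u)) with
      (u / (1 - RtoC t * u) - u - RtoC t * u ^ 2).
    + unfold Re; simpl; ring.
    + rewrite RtoC_pow; cbn [Nat.add]; simpl; field; auto.
  - simpl log_tail_deriv.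
    rewrite <- Rplus_assoc, IH, <- (Re_scal (t ^ (J + 2))).
    replace (u ^ (S J + 3) * RtoC (t ^ (S J + 2)) / (1 - RtoC t * u)) with
      (u ^ (J + 3) * RtoC (t ^ (J + 2)) / (1 - RtoC t * u) - RtoC (t ^ (J + 2)) * u ^ (J + 3)).
    + unfold Re; simpl; ring.
    + rewrite !RtoC_pow; cbn [Nat.add]; rewrite !Cpow_S; field; auto.
Qed.

Lemma ln_Cmod_derive (u : C) t : (0 < Cmod (1 - RtoC t * u))%R ->
  is_derive (fun t : R => ln (Cmod (1 - RtoC t * u))) t (- Re (u / (1 - RtoC t * u)))%R.
Proof.
  intros H; destruct u as [x y].
  assert (E : forall s, Cmod (1 - RtoC s * (x, y)) = sqrt ((1 - s * x) ^ 2 + (s * y) ^ 2)).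
  { intros s; unfold Cmod; f_equal; simpl; ring. }
  assert (H2 : (0 < (1 - t * x) ^ 2 + (t * y) ^ 2)%R).
  { rewrite E in H; apply Rnot_le_lt; intros H0; rewrite sqrt_neg_0 in H; lra. }
  apply is_derive_ext with (fun s => ln (sqrt ((1 - s * x) ^ 2 + (s * y) ^ 2)));
    [intros s; now rewrite E|].
  assert (H3 := sqrt_lt_R0 _ H2).
  assert (H4 := sqrt_sqrt _ (Rlt_le _ _ H2)).
  auto_derive.
  - simpl in *; repeat split; auto; lra.
  - simpl in *.
    set (q := sqrt _) in *.
    match goal with |- _ = ?r => 
      replace r with (- (x * (1 - t * x) - y * (t * y)) / ((1 - t * x) * ((1 - t * x) * 1) + t * y * (t * y * 1)))%R
    end.
    + rewrite <- H4; field; lra.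
    + unfold Re, Cdiv, Cinv; simpl; field; lra.
Qed.

(** Mean value theorem along the segment t u, 0 <= t <= 1, so that only the real logarithm of a
    modulus occurs. The factor 2 bounds 1 / |1 - t u| for |u| <= 1/2. *)
Lemma ln_one_minus_bound J (u : C) : (Cmod u <= 1 / 2)%R ->
  (Rabs (ln (Cmod (1 - u)) + Re (u + RtoC (/2) * u ^ 2 + log_tail J u))
   <= 2 * Cmod u ^ (J + 3))%R.
Proof.
  intros Hu.
  set (f := fun t : R => (ln (Cmod (1 - RtoC t * u)) +
     (t * Re u + t ^ 2 / 2 * Re (u ^ 2) + Re (log_tail J (RtoC t * u))))%R).
  set (df := fun t : R => (- Re (u / (1 - RtoC t * u)) + Re u + t * Re (u ^ 2)
     + log_tail_deriv J u t)%R).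
  assert (Hd : forall t, (0 <= t <= 1)%R -> is_derive f t (df t)).
  { intros t Ht; unfold f, df.
    replace (- Re (u / (1 - RtoC t * u)) + Re u + t * Re (u ^ 2) + log_tail_deriv J u t)%R
      with (- Re (u / (1 - RtoC t * u)) +
        ((Re u + t * Re (u ^ 2)) + log_tail_deriv J u t))%R by ring.
    apply (is_derive_plus (K := R_AbsRing) (V := R_NormedModule)).
    - apply ln_Cmod_derive; assert (A := one_minus_nz u t Hu Ht); lra.
    - apply (is_derive_plus (K := R_AbsRing) (V := R_NormedModule)); [|apply log_tail_is_derive].
      auto_derive; auto; simpl; field. }
  destruct (MVT_cor2 f df 0 1) as (t & E & Ht); [lra | |].
  { intros t Ht; apply is_derive_Reals; auto. }
  assert (E0 : f 0%R = 0%R).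
  { unfold f; replace (1 - 0 * u) with (RtoC 1) by ring; rewrite Cmod_1, ln_1.
    assert (Z : log_tail J (0 * u) = 0).
    { clear; induction J as [|J IH]; simpl; auto; rewrite IH.
      replace (J + 3)%nat with (S (J + 2)) by lia; simpl; ring. }
    rewrite Z; simpl; field. }
  assert (E1 : f 1%R = (ln (Cmod (1 - u)) + Re (u + RtoC (/2) * u ^ 2 + log_tail J u))%R).
  { unfold f; replace (1 * u) with u by ring; f_equal.
    unfold Re; simpl; field. }
  rewrite <- E1; rewrite E0 in E; replace (f 1%R) with (df t) by lra.
  assert (Hn := one_minus_nz u t Hu ltac:(lra)).
  unfold df; rewrite log_tail_geometric by (apply nz_of_Cmod; lra).
  rewrite Rabs_Ropp; eapply Rle_trans; [apply re_le_Cmod|].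
  rewrite Cmod_div by (apply nz_of_Cmod; lra).
  rewrite Cmod_mult, Cmod_pow, Cmod_R.
  assert (Hp : (0 <= Cmod u ^ (J + 3))%R) by apply pow_le, Cmod_ge_0.
  assert (Ht1 : (Rabs (t ^ (J + 2)) <= 1)%R).
  { rewrite <- RPow_abs, Rabs_pos_eq by lra; rewrite <- (pow1 (J + 2)); apply pow_incr; lra. }
  apply Rmult_le_reg_r with (Cmod (1 - RtoC t * u)); [lra|].
  unfold Rdiv; rewrite Rmult_assoc, Rinv_l, Rmult_1_r by lra.
  assert (A := Rabs_pos (t ^ (J + 2))); nra.
Qed.

(** * The approximate Green function *)

(** The logarithm is available only as the real function ln |z|, so real functions are compared with
    real parts of spans, to one fixed order [N]. *)
Definition RExp (N : nat) (d : Z) (f : C -> R) : Prop :=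
  exists P, Span d P /\ exists B M : R, (1 <= M)%R /\
    forall z, (M <= Cmod z)%R -> (Rabs (f z - Re (P z)) <= B / Cmod z ^ N)%R.

Lemma RExp_Re N d F : Exp d F -> RExp N d (fun z => Re (F z)).
Proof.
  intros H; destruct (H N) as (P & HP & B & M & HM & HB).
  exists P; split; auto; exists B, M; split; auto; intros z Hz.
  replace (Re (F z) - Re (P z))%R with (Re (F z - P z)) by (unfold Re; simpl; ring).
  eapply Rle_trans; [apply re_le_Cmod | auto].
Qed.

Lemma RExp_plus N d f g : RExp N d f -> RExp N d g -> RExp N d (fun z => f z + g z)%R.
Proof.
  intros (P & HP & B & M & HM & HB) (P' & HP' & B' & M' & HM' & HB').
  exists (fun z => P z + P' z); split; [now apply Span_plus|].
  exists (B + B')%R, (Rmax M M'); split; [eapply Rle_trans; [exact HM | apply Rmax_l]|].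
  intros z Hz.
  assert (Hz1 : (M <= Cmod z)%R) by (eapply Rle_trans; [apply Rmax_l | exact Hz]).
  assert (Hz2 : (M' <= Cmod z)%R) by (eapply Rle_trans; [apply Rmax_r | exact Hz]).
  specialize (HB z Hz1); specialize (HB' z Hz2).
  replace (f z + g z - Re (P z + P' z))%R with ((f z - Re (P z)) + (g z - Re (P' z)))%R
    by (unfold Re; simpl; ring).
  eapply Rle_trans; [apply Rabs_triang|]; unfold Rdiv in *; lra.
Qed.

Lemma RExp_scal N d c f : RExp N d f -> RExp N d (fun z => c * f z)%R.
Proof.
  intros (P & HP & B & M & HM & HB).
  exists (fun z => RtoC c * P z); split; [now apply Span_scal|].
  exists (Rabs c * B)%R, M; split; auto; intros z Hz.
  rewrite Re_scal, <- Rmult_minus_distr_l, Rabs_mult.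
  unfold Rdiv; rewrite Rmult_assoc; apply Rmult_le_compat_l; [apply Rabs_pos | now apply HB].
Qed.

Lemma RExp_le N d d' f : (d' <= d)%Z -> RExp N d f -> RExp N d' f.
Proof. intros Hd (P & HP & H); exists P; split; auto; eapply Span_le; eauto. Qed.

Lemma RExp_ext N d f g : (forall z, f z = g z) -> RExp N d f -> RExp N d g.
Proof.
  intros E (P & HP & B & M & HM & HB); exists P; split; auto; exists B, M; split; auto.
  intros z Hz; rewrite <- E; auto.
Qed.

Lemma RExp_zero N d : RExp N d (fun _ => 0%R).
Proof.
  apply (RExp_ext N d (fun z => Re (RtoC 0))); [reflexivity|].
  apply (RExp_Re N d (fun _ => RtoC 0)), Exp_Span; constructor.
Qed.

Lemma RExp_lsum {T} N d (f : T -> C -> R) s : (forall a, RExp N d (f a)) ->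
  RExp N d (fun z => lsum (fun a => f a z) s).
Proof.
  intros H; induction s as [|a s IH]; simpl; [apply RExp_zero | now apply RExp_plus].
Qed.

(** The part u + u^2 / 2 of -ln (1 - u) at u = conj w zeta, relevant because |z - w| / |z| = |1 -
    conj w / conj z|. *)
Definition log_taylor2 (w z : C) : C :=
  Cconj w * mono 0 1 z + Cconj w ^ 2 * (RtoC (/2) * mono 0 2 z).

Lemma RExp_ln_shift2 N (w : C) :
  RExp N 3 (fun z => ln (Cmod (z - w)) - ln (Cmod z) + Re (log_taylor2 w z))%R.
Proof.
  exists (fun z => (-1) * log_tail N (Cconj w * mono 0 1 z)); split.
  - apply Span_scal; induction N as [|N IH]; simpl.
    + constructor.
    + apply Span_plus; auto; apply Span_scal.
      replace (fun z => (Cconj w * mono 0 1 z) ^ (N + 3)) with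
        (fun z => Cconj w ^ (N + 3) * mono 0 (N + 3) z).
      * apply Span_scal, Span_mono; lia.
      * extensionality z; rewrite Cpow_mult_l; unfold mono; simpl (_ ^ 0).
        rewrite !Cmult_1_l; now rewrite Cpow_1_r.
  - exists (2 * Cmod w ^ (N + 3))%R, (2 * Cmod w + 1)%R.
    assert (W := Cmod_ge_0 w); split; [lra|]; intros z Hz.
    destruct (large_shift_nz w z) as [Hz0 Hz1]; [lra|].
    assert (Pz : (0 < Cmod z)%R) by lra.
    set (u := Cconj w * mono 0 1 z).
    assert (Hu : Cmod u = (Cmod w / Cmod z)%R).
    { unfold u; rewrite Cmod_mult, Cmod_conj, Cmod_mono by auto; simpl; field; lra. }
    assert (E : (ln (Cmod (z - w)) - ln (Cmod z))%R = ln (Cmod (1 - u))).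
    { replace (Cmod (z - w)) with (Cmod z * Cmod (1 - u))%R.
      - rewrite ln_mult; [ring | auto|].
        apply (proj1 (Cmod_gt_0 _)); intros H0; apply Hz1.
        assert (Hc : Cconj z * (1 - u) = Cconj (z - w)).
        { unfold u, mono; simpl; rewrite Cminus_conj.
          transitivity (Cconj z - Cconj w * (zeta z * Cconj z)); [ring|].
          rewrite zeta_conj by auto; ring. }
        rewrite H0, Cmult_0_r in Hc.
        apply Cmod_eq_0; rewrite <- Cmod_conj, <- Hc; apply Cmod_0.
      - rewrite <- (Cmod_conj z), <- Cmod_mult, <- (Cmod_conj (z - w)); f_equal.
        unfold u, mono; simpl; rewrite Cminus_conj.
        transitivity (Cconj z - Cconj w * (zeta z * Cconj z)); [ring|].
        rewrite zeta_conj by auto; ring. }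
    rewrite E.
    replace (ln (Cmod (1 - u)) + Re (log_taylor2 w z) - Re (-1 * log_tail N u))%R
      with (ln (Cmod (1 - u)) + Re (u + RtoC (/2) * u ^ 2 + log_tail N u))%R.
    + eapply Rle_trans; [apply ln_one_minus_bound|].
      * rewrite Hu; apply Rmult_le_reg_r with (Cmod z); auto.
        unfold Rdiv; rewrite Rmult_assoc, Rinv_l by lra; lra.
      * rewrite Hu; unfold Rdiv; rewrite Rpow_mult_distr, pow_inv, Rmult_assoc.
        apply Rmult_le_compat_l; [lra|].
        apply Rmult_le_compat_l; [now apply pow_le|].
        apply Rinv_le_contravar; [now apply pow_lt | apply Rle_pow; lia || lra].
    + replace (log_taylor2 w z) with (u + RtoC (/2) * u ^ 2).
      * unfold Re; simpl; ring.
      * unfold log_taylor2, u, mono; simpl; ring.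
Qed.

Lemma RExp_ln_shift N (w : C) : RExp N 1 (fun z => ln (Cmod (z - w)) - ln (Cmod z))%R.
Proof.
  apply (RExp_ext N 1 (fun z => (ln (Cmod (z - w)) - ln (Cmod z) + Re (log_taylor2 w z))
    + (-1) * Re (log_taylor2 w z))%R); [intros; ring|].
  apply RExp_plus; [eapply RExp_le; [|apply RExp_ln_shift2]; lia|].
  apply RExp_scal, RExp_Re, Exp_Span, Span_plus;
    [apply Span_scal | apply Span_scal, Span_scal]; apply Span_mono; lia.
Qed.

(** The logarithm is normalised to coefficient 1; [alpha] arises only later, as the mass of [nu]. *)
Definition green (P : C -> C) (z : C) : R := (ln (Cmod z) + Re (P z))%R.

Definition ravg (f : C -> R) (z : C) : R := lsum (fun w => p w * f (z - em w)%C)%R l.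

Lemma ravg_Re F z : ravg (fun z => Re (F z)) z = Re (avg F z).
Proof.
  unfold ravg, avg; rewrite Re_csum; apply lsum_ext; intros w _; now rewrite Re_scal.
Qed.

Lemma ravg_plus f g z : ravg (fun z => f z + g z)%R z = (ravg f z + ravg g z)%R.
Proof. unfold ravg; rewrite <- lsum_plus; apply lsum_ext; intros; ring. Qed.

(** Since ln |z| is harmonic, its expansion has no w conj w term, and the pure terms average to zero
    by the moment conditions. Hence the first error has order 3, exactly the threshold of
    [avg_solve]. *)
Lemma ravg_ln N : RExp N 3 (fun z => ravg (fun z => ln (Cmod z)) z - ln (Cmod z))%R.
Proof.
  apply (RExp_ext N 3 (fun z => lsum (fun w =>
     p w * (ln (Cmod (z - em w)) - ln (Cmod z) + Re (log_taylor2 (em w) z)))%R l)).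
  - intros z; unfold ravg.
    rewrite (lsum_ext _ (fun w => p w * ln (Cmod (z - em w))
       + ((- ln (Cmod z)) * p w + Re (RtoC (p w) * log_taylor2 (em w) z)))%R)
      by (intros; rewrite Re_scal; ring).
    rewrite !lsum_plus, lsum_scal, <- (Re_csum (fun w => RtoC (p w) * log_taylor2 (em w) z)).
    rewrite (csum_ext _ (fun w => RtoC (p w) * Cconj (em w) * mono 0 1 z
       + RtoC (p w) * Cconj (em w) ^ 2 * (RtoC (/2) * mono 0 2 z)))
      by (intros; unfold log_taylor2; ring).
    rewrite csum_plus, !csum_scal_r.
    destruct Hmom as (-> & _ & -> & _ & -> & _).
    replace (0 * mono 0 1 z + 0 * (RtoC (/2) * mono 0 2 z)) with (RtoC 0) by ring.
    simpl; ring.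
  - apply (RExp_lsum N 3 (fun w z =>
      p w * (ln (Cmod (z - em w)) - ln (Cmod z) + Re (log_taylor2 (em w) z)))%R).
    intros w; apply RExp_scal, RExp_ln_shift2.
Qed.

Lemma green_exists N : exists P, Span 1 P /\ exists B M : R, (1 <= M)%R /\
  forall z, (M <= Cmod z)%R -> (Rabs (ravg (green P) z - green P z) <= B / Cmod z ^ N)%R.
Proof.
  assert (H : forall k, exists P, Span 1 P /\
    RExp N (3 + Z.of_nat k) (fun z => ravg (green P) z - green P z)%R).
  { induction k as [|k (P & HP & Q & HQ & HB)].
    - exists (fun _ => RtoC 0); split; [constructor|].
      apply (RExp_ext N 3 (fun z => ravg (fun z => ln (Cmod z)) z - ln (Cmod z))%R);
        [|apply ravg_ln].
      intros z; unfold green, ravg; f_equal; [|simpl; ring].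
      apply lsum_ext; intros; simpl; ring.
    - destruct (avg_solve (3 + Z.of_nat k) Q) as (U & HU & HE); auto; [lia|].
      exists (fun z => P z + U z); split; [now apply Span_plus|].
      apply (RExp_ext N _ (fun z => (ravg (green P) z - green P z - Re (Q z))
         + Re (avg U z - U z + Q z))%R).
      + intros z; unfold green.
        rewrite !ravg_plus.
        rewrite (ravg_Re (fun z => P z + U z)), (ravg_Re P), avg_plus.
        unfold Re; simpl; ring.
      + apply RExp_plus.
        * exists (fun _ => RtoC 0); split; [constructor|].
          destruct HB as (B & M & HM & HB); exists B, M; split; auto; intros z Hz.
          simpl (Re 0); rewrite Rminus_0_r; auto.
        * apply (RExp_le N (3 + Z.of_nat k + 1)); [lia | now apply RExp_Re]. }
  (* At k = N the leftover span has order N + 3 and can be bounded together with the expansion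
     error. *)
  destruct (H N) as (P & HP & Q & HQ & B & M & HM & HB).
  exists P; split; auto.
  destruct (Span_bigO N Q) as (B' & M' & HM' & HB'); [eapply Span_le; [|exact HQ]; lia|].
  exists (B + B')%R, (Rmax M M'); split; [eapply Rle_trans; [exact HM | apply Rmax_l]|].
  intros z Hz.
  assert (Hz1 : (M <= Cmod z)%R) by (eapply Rle_trans; [apply Rmax_l | exact Hz]).
  assert (Hz2 : (M' <= Cmod z)%R) by (eapply Rle_trans; [apply Rmax_r | exact Hz]).
  specialize (HB z Hz1); specialize (HB' z Hz2).
  replace (ravg (green P) z - green P z)%R with
    ((ravg (green P) z - green P z - Re (Q z)) + Re (Q z))%R by ring.
  eapply Rle_trans; [apply Rabs_triang|].
  assert (R := re_le_Cmod (Q z)); unfold Rdiv in *; lra.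
Qed.

End Laplacian.

Lemma RExp_green_shift N P (w : C) : Span 1 P ->
  RExp N 1 (fun z => green P (z - w)%C - ln (Cmod z))%R.
Proof.
  intros HP.
  apply (RExp_ext N 1 (fun z => (ln (Cmod (z - w)) - ln (Cmod z)) + Re (P (z - w)%C))%R).
  - intros z; unfold green; ring.
  - apply RExp_plus; [apply RExp_ln_shift|].
    apply (RExp_Re N 1 (fun z => P (z - w))), Exp_Span_shift; auto.
Qed.

(* The statement's expansion has at most one coefficient per exponent pair, whereas a
   [Span] combination may repeat monomials. *)
Lemma Span_expansion K P : Span 1 P -> exists (idx : list (nat * nat)) (coef : nat * nat -> C),
  NoDup idx /\
  (forall lk, In lk idx -> (fst lk + 1 <= snd lk)%nat /\ (snd lk <= fst lk + K)%nat
     /\ (snd lk <= 2 * fst lk)%nat) /\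
  bigO K (fun z => P z - expansion coef idx z).
Proof.
  induction 1 as [|c a b P Hab HP (idx & coef & Hnd & Hidx & HO)].
  - exists nil, (fun _ => RtoC 0); split; [constructor|]; split; [intros ? []|].
    apply Span_bigO; simpl; replace (fun _ : C => 0 - 0) with (fun _ : C => RtoC 0);
      [constructor | extensionality z; ring].
  (* Here a < b, so the subtraction is exact. A monomial of order at least [K] goes into the
     error. *)
  - destruct (le_lt_dec K (b - a)) as [HK|HK].
    + exists idx, coef; repeat split; try (apply Hidx; auto); auto.
      replace (fun z => c * mono a b z + P z - expansion coef idx z) with
        (fun z => c * mono a b z + (P z - expansion coef idx z)) by (extensionality z; ring).
      apply bigO_plus; auto; apply bigO_scal, Span_bigO, Span_mono; lia.
    (* The exponents (l, k) of z^a zeta^b. From 2 b <= 2 (a + b) comes k <= 2 l, the source of the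
       vanishing condition. *)
    + set (key := (a + b, 2 * b)%nat).
      assert (dec : forall x y : nat * nat, {x = y} + {x <> y})
        by (decide equality; apply Nat.eq_dec).
      set (old := if in_dec dec key idx then coef key else RtoC 0).
      set (coef' := fun lk => if dec lk key then c + old else coef lk).
      set (idx' := if in_dec dec key idx then idx else key :: idx).
      assert (Hout : forall s z, ~ In key s -> expansion coef' s z = expansion coef s z).
      { intros s z; induction s as [|lk s IH]; simpl; auto; intros Hn.
        rewrite IH by tauto; unfold coef'; destruct (dec lk key) as [->|]; [tauto | auto]. }
      assert (Hin : forall s z, NoDup s -> In key s ->
        expansion coef' s z = expansion coef s z
          + (coef' key - coef key) * (cpow z (a + b) * RtoC (/ Cmod z ^ (2 * b)))).
      { intros s z; induction s as [|lk s IH]; [intros _ []|].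
        intros Hs Hi; inversion Hs; subst.
        destruct (dec lk key) as [->|Hne].
        - simpl; rewrite Hout by auto; simpl; ring.
        - destruct Hi as [?|Hi]; [tauto|]; simpl; rewrite IH by auto.
          replace (coef' lk) with (coef lk)
            by (unfold coef'; destruct (dec lk key); tauto).
          simpl; ring. }
      assert (Hkey : coef' key = c + old) by (unfold coef'; destruct (dec key key); tauto).
      exists idx', coef'; split; [|split].
      * unfold idx'; destruct (in_dec dec key idx); auto; now constructor.
      * intros lk Hlk; assert (Hc : lk = key \/ In lk idx).
        { unfold idx' in Hlk; destruct (in_dec dec key idx); auto.
          destruct Hlk; auto. }
        destruct Hc as [->|]; auto; unfold key; simpl; lia.
      * apply bigO_ext with (fun z => P z - expansion coef idx z); auto.
        exists 1%R; intros z Hz.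
        assert (Hz0 : z <> 0) by (apply nz_of_Cmod; lra).
        rewrite (mono_expansion a b z Hz0).
        unfold idx', old in *; destruct (in_dec dec key idx) as [Hi|Hi].
        -- rewrite (Hin idx z Hnd Hi), Hkey; ring.
        -- assert (Ec : expansion coef' (key :: idx) z =
             coef' key * (cpow z (a + b) * RtoC (/ Cmod z ^ (2 * b))) + expansion coef' idx z)
             by reflexivity.
           rewrite Ec, (Hout idx z Hi), Hkey; ring.
Qed.

Close Scope C_scope.

(** * Escape to infinity *)

Definition zrange (k : nat) : list Z := map (fun i => (Z.of_nat i - Z.of_nat k)%Z) (seq 0 (2 * k + 1)).
Definition box (k : nat) : list pt := list_prod (zrange k) (zrange k).

Lemma in_zrange k x : (Z.abs x <= Z.of_nat k)%Z -> In x (zrange k).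
Proof.
  intros H; apply in_map_iff; exists (Z.to_nat (x + Z.of_nat k)); split; [lia|].
  apply in_seq; lia.
Qed.

Lemma in_box_wt R : exists k, forall z, wt z <= R -> In z (box k).
Proof.
  exists (Z.to_nat (up R)); intros [m n] H; apply in_prod; apply in_zrange;
    unfold wt in H; simpl in H; destruct (archimed R) as [HR _];
    rewrite <- !abs_IZR in H;
    assert (A := IZR_le 0 _ (Z.abs_nonneg m)); assert (B := IZR_le 0 _ (Z.abs_nonneg n)).
  - assert (Z.abs m < up R)%Z by (apply lt_IZR; lra); lia.
  - assert (Z.abs n < up R)%Z by (apply lt_IZR; lra); lia.
Qed.

(** Built from translates of [delta], so that its iterates are controlled by those of [delta]; it
    dominates the indicator of the box. *)
Definition boxind (k : nat) : pt -> R := act (map (fun w => (1, w)) (box k)) delta.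

Lemma delta_nonneg z : 0 <= delta z.
Proof. unfold delta; destruct (_ && _)%bool; lra. Qed.

Lemma boxind_eq k z : boxind k z = lsum (fun w => delta (zsub z w)) (box k).
Proof.
  unfold boxind, act; rewrite lsum_map; apply lsum_ext; intros; simpl; ring.
Qed.

Lemma boxind_nonneg k z : 0 <= boxind k z.
Proof. rewrite boxind_eq; apply lsum_nonneg; intros; apply delta_nonneg. Qed.

Lemma boxind_ge1 k z : In z (box k) -> 1 <= boxind k z.
Proof.
  intros H; rewrite boxind_eq.
  replace 1 with (delta (zsub z z)).
  - apply (lsum_ge_elem (fun w => delta (zsub z w))); auto; intros; apply delta_nonneg.
  - unfold delta, zsub; simpl; now rewrite !Z.sub_diag.
Qed.

(* [delta] is dominated by the gradient in direction [x] of the indicator of the ray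
   spanned by [x]. *)
Lemma iter_delta_small mu x : prob mu -> smoothing mu x -> x <> (0, 0)%Z ->
  exists C, 0 <= C /\ forall k z, 0 <= Nat.iter k (act mu) delta z <= C / sqrt (INR k + 1).
Proof.
  intros Hmu [C [HC HS]] Hx; exists C; split; auto; intros k z.
  set (q := fun y : pt => if ((fst y * snd x =? snd y * fst x)%Z
     && (0 <=? fst y * fst x + snd y * snd x)%Z)%bool then 1 else 0).
  assert (Hq : forall y, Rabs (q y) <= 1).
  { intros y; unfold q; destruct (_ && _)%bool; rewrite ?Rabs_R1, ?Rabs_R0; lra. }
  assert (Hle : forall y, delta y <= act (grad x) q y).
  { intros y; rewrite grad_eq; unfold delta, q, zsub; destruct x as [a b], y as [c d]; cbn [fst snd].
    assert (0 < a * a + b * b)%Z.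
    { assert (a <> 0 \/ b <> 0)%Z by (destruct (Z.eq_dec a 0), (Z.eq_dec b 0); subst; auto).
      nia. }
    destruct (Z.eqb_spec (c * b) (d * a)), (Z.leb_spec 0 (c * a + d * b)),
      (Z.eqb_spec ((c - a) * b) ((d - b) * a)), (Z.leb_spec 0 ((c - a) * a + (d - b) * b)),
      (Z.eqb_spec c 0), (Z.eqb_spec d 0); simpl; try lra; subst; exfalso; nia. }
  split.
  - rewrite <- (iter_const mu k 0 z Hmu); apply iter_le; auto; apply delta_nonneg.
  - eapply Rle_trans; [apply (iter_le mu k _ _ Hmu Hle)|].
    rewrite <- act_iter_comm.
    eapply Rle_trans; [apply Rle_abs|].
    eapply Rle_trans; [apply (HS q 1); auto | rewrite Rmult_1_r; lra].
Qed.

Lemma inv_sqrt_small C eps : 0 < eps -> exists n0 : nat, forall n, (n0 <= n)%nat ->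
  C / sqrt (INR n + 1) <= eps.
Proof.
  intros He; set (y := Rabs C / eps).
  assert (Hy : 0 <= y) by (apply Rdiv_le_0_compat; auto using Rabs_pos).
  destruct (nfloor_ex (y ^ 2)) as [n0 [_ Hn0]]; [now apply pow_le|].
  exists n0; intros n Hn; apply le_INR in Hn.
  assert (Hs : y <= sqrt (INR n + 1)).
  { rewrite <- (sqrt_pow2 y) by auto; apply sqrt_le_1_alt; lra. }
  assert (0 < sqrt (INR n + 1)) by (apply sqrt_lt_R0; assert (A := pos_INR n); lra).
  apply Rmult_le_reg_r with (sqrt (INR n + 1)); auto.
  unfold Rdiv; rewrite Rmult_assoc, Rinv_l by lra.
  apply Rle_trans with (eps * y); [|apply Rmult_le_compat_l; lra].
  unfold y; replace (eps * (Rabs C / eps)) with (Rabs C) by (field; lra).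
  rewrite Rmult_1_r; apply Rle_abs.
Qed.

Lemma iter_boxind_small mu x k eps : prob mu -> smoothing mu x -> x <> (0, 0)%Z -> 0 < eps ->
  exists n0 : nat, forall n z, (n0 <= n)%nat -> Nat.iter n (act mu) (boxind k) z <= eps.
Proof.
  intros Hmu HS Hx He.
  destruct (iter_delta_small mu x Hmu HS Hx) as (C & HC & HB).
  set (nu := map (fun w : pt => (1, w)) (box k)).
  destruct (inv_sqrt_small (lsum (fun cw => Rabs (fst cw)) nu * C) eps He) as [n0 Hn0].
  exists n0; intros n z Hn; unfold boxind; fold nu.
  rewrite <- act_iter_comm.
  eapply Rle_trans; [apply Rle_abs|].
  eapply Rle_trans; [|apply (Hn0 n Hn)].
  eapply Rle_trans; [apply (act_abs_le nu _ (C / sqrt (INR n + 1)))|].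
  - intros cw _; rewrite Rabs_pos_eq; apply HB.
  - unfold Rdiv; rewrite Rmult_assoc; apply Rle_refl.
Qed.

Lemma sum_Sn_R (a : nat -> R) n : sum_n a (S n) = sum_n a n + a (S n).
Proof. exact (sum_Sn a n). Qed.

(** Off a large box |f| is at most eps / 2, and the mass inside the box dies out. The box
    contributes C eps / (2 (C + 1)), where the added 1 covers C = 0. *)
Lemma iter_Decay1_vanish mu x f eps : prob mu -> smoothing mu x -> x <> (0, 0)%Z ->
  Decay 1 f -> 0 < eps ->
  exists n0 : nat, forall n z, (n0 <= n)%nat -> Rabs (Nat.iter n (act mu) f z) <= eps.
Proof.
  intros Hmu HS Hx [C HC] He; assert (C0 := Decay_cst_nonneg _ _ _ HC).
  destruct (in_box_wt (2 * C / eps)) as [k Hk].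
  destruct (iter_boxind_small mu x k (eps / (2 * (C + 1))) Hmu HS Hx) as [n0 Hn0].
  { apply Rdiv_lt_0_compat; lra. }
  exists n0; intros n z Hn.
  set (h := fun z => eps / 2 + C * boxind k z).
  assert (Hh : forall z, Rabs (f z) <= h z).
  { intros y; unfold h; assert (A := boxind_nonneg k y); assert (W := wt_ge1 y).
    specialize (HC y); rewrite pow_1 in HC.
    destruct (Rle_or_lt (wt y) (2 * C / eps)) as [Hy|Hy].
    - assert (B := boxind_ge1 k y (Hk y Hy)).
      assert (C / wt y <= C); [|nra].
      apply Rmult_le_reg_r with (wt y); [lra|].
      unfold Rdiv; rewrite Rmult_assoc, Rinv_l by lra; nra.
    - assert (C / wt y <= eps / 2); [|nra].
      apply Rmult_le_reg_r with (wt y); [lra|].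
      unfold Rdiv at 1; rewrite Rmult_assoc, Rinv_l by lra.
      apply Rle_trans with (eps / 2 * (2 * C / eps)); [apply Req_le; field; lra|].
      apply Rmult_le_compat_l; lra. }
  assert (Ih : Nat.iter n (act mu) h z <= eps).
  { unfold h; rewrite (iter_plus mu n (fun _ => eps / 2)), iter_scal, iter_const by auto.
    specialize (Hn0 n z Hn).
    apply Rle_trans with (eps / 2 + C * (eps / (2 * (C + 1)))).
    - apply Rplus_le_compat_l, Rmult_le_compat_l; auto.
    - replace (C * (eps / (2 * (C + 1)))) with (eps / 2 * (C / (C + 1))) by (field; lra).
      assert (C / (C + 1) <= 1); [|nra].
      apply Rmult_le_reg_r with (C + 1); [lra|].
      unfold Rdiv; rewrite Rmult_assoc, Rinv_l by lra; lra. }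
  apply Rabs_le; split.
  - assert (E : Nat.iter n (act mu) (fun z => (-1) * h z) z <= Nat.iter n (act mu) f z).
    { apply iter_le; auto; intros y; specialize (Hh y).
      assert (A := Rle_abs (- f y)); rewrite Rabs_Ropp in A; lra. }
    rewrite iter_scal in E; lra.
  - eapply Rle_trans; [|exact Ih]; apply iter_le; auto; intros y.
    eapply Rle_trans; [apply Rle_abs | apply Hh].
Qed.

(** * Walks *)

Definition walk (p : pt -> R) (supp : list pt) : list (R * pt) := map (fun w => (p w, w)) supp.

Definition lazy (mu : list (R * pt)) : list (R * pt) := (/ 2, (0, 0)%Z) :: scale (/ 2) mu.

Lemma act_walk p supp f z : act (walk p supp) f z = lsum (fun w => p w * f (zsub z w)) supp.
Proof. unfold act, walk; now rewrite lsum_map. Qed.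

Lemma act_lazy mu f z : act (lazy mu) f z = (f z + act mu f z) / 2.
Proof. unfold lazy; rewrite act_cons, act_scale, zsub_0_r; field. Qed.

Lemma Pn_iter p supp n : Pn p supp n = Nat.iter n (act (walk p supp)) delta.
Proof.
  induction n as [|n IH]; [reflexivity|]; extensionality z; simpl.
  now rewrite <- IH, act_walk.
Qed.

Lemma prob_walk p supp : step_law p supp -> prob (walk p supp).
Proof.
  intros (_ & Hp & _ & H1); split.
  - intros cw Hcw; apply in_map_iff in Hcw; destruct Hcw as (w & <- & _); apply Hp.
  - unfold walk; rewrite lsum_map; exact H1.
Qed.

Lemma prob_lazy mu : prob mu -> prob (lazy mu).
Proof.
  intros [Hp H1]; split.
  - intros cw [<-|Hcw]; simpl; [lra|].
    apply in_map_iff in Hcw; destruct Hcw as (w & <- & Hw); simpl.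
    specialize (Hp w Hw); lra.
  - unfold lazy, scale; simpl; rewrite lsum_map; simpl.
    rewrite lsum_scal, H1; lra.
Qed.

Lemma smoothing_0 mu : smoothing mu (0, 0)%Z.
Proof.
  exists 0; split; [lra|]; intros f B k z _; rewrite grad_eq, zsub_0_r, Rminus_diag, Rabs_R0.
  unfold Rdiv; lra.
Qed.

Lemma smoothing_add mu z w : smoothing mu (zsub z w) -> smoothing mu w -> smoothing mu z.
Proof.
  intros (C & HC & H) (C' & HC' & H'); exists (C + C'); split; [lra|].
  intros f B k x HB; specialize (H f B k (zsub x w) HB); specialize (H' f B k x HB).
  rewrite grad_eq in *.
  replace (zsub (zsub x w) (zsub z w)) with (zsub x z) in H
    by (unfold zsub; cbn [fst snd]; f_equal; ring).
  set (h := Nat.iter k (act mu) f) in *.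
  replace (h x - h (zsub x z)) with ((h (zsub x w) - h (zsub x z)) + (h x - h (zsub x w))) by ring.
  eapply Rle_trans; [apply Rabs_triang|]; unfold Rdiv in *; lra.
Qed.

Lemma lsum_pos_ex {A} (f : A -> R) l : 0 < lsum f l -> exists a, In a l /\ 0 < f a.
Proof.
  induction l as [|a l IH]; simpl; intros H; [lra|].
  destruct (Rlt_or_le 0 (f a)); [exists a; auto|].
  destruct IH as (b & Hb & Hfb); [lra | exists b; auto].
Qed.

Lemma Pn_nonneg p supp n : (forall w, 0 <= p w) -> forall z, 0 <= Pn p supp n z.
Proof.
  intros Hp; induction n as [|n IH]; intros z; simpl; [apply delta_nonneg|].
  apply lsum_nonneg; intros; now apply Rmult_le_pos.
Qed.

(** Induction along a path: a point of positive probability at time n + 1 has, one possible step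
    back, a predecessor of positive probability at time n. *)
Lemma reachable_ind p supp (S : pt -> Prop) : (forall w, 0 <= p w) ->
  S (0, 0)%Z ->
  (forall z w, In w supp -> 0 < p w -> S (zsub z w) -> S z) ->
  forall n z, 0 < Pn p supp n z -> S z.
Proof.
  intros Hp S0 Hstep; induction n as [|n IH]; intros z Hz.
  - simpl in Hz; destruct z as [a b]; simpl in Hz.
    destruct (Z.eqb_spec a 0), (Z.eqb_spec b 0); simpl in Hz; subst; auto; lra.
  - simpl in Hz; destruct (lsum_pos_ex _ _ Hz) as (w & Hw & Hpos).
    assert (A := Hp w); assert (B := Pn_nonneg p supp n Hp (zsub z w)).
    assert (0 < p w) by (destruct A as [|A]; auto; rewrite <- A in Hpos; lra).
    apply (Hstep z w); auto; apply IH.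
    destruct B as [|B]; auto; rewrite <- B in Hpos; lra.
Qed.

(** The atoms at 0 and at a possible step [w] make [w] smoothing. Sums of possible steps follow, and
    by irreducibility every lattice point is such a sum. *)
Lemma lazy_smoothing p supp x : step_law p supp -> irreducible_walk p supp ->
  smoothing (lazy (walk p supp)) x.
Proof.
  intros Hlaw Hirr; destruct (Hirr x) as [n Hn]; revert n x Hn.
  assert (Hmu := prob_lazy _ (prob_walk _ _ Hlaw)).
  destruct Hlaw as (_ & Hp & _).
  apply reachable_ind; auto using smoothing_0.
  intros z w Hw Hpw Hz; apply (smoothing_add _ z w); auto.
  assert (Dec : {w = (0, 0)%Z} + {w <> (0, 0)%Z}) by (decide equality; apply Z.eq_dec).
  destruct Dec as [->|Hw0]; [apply smoothing_0|].
  rewrite <- (zsub_0_r w).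
  apply (grad_iter_bound _ (0, 0)%Z w (/ 2) (/ 2 * p w)); auto; try lra.
  - now left.
  - right; unfold scale, walk; rewrite map_map; apply in_map_iff; exists w; auto.
Qed.

Section Walk.

Variables (v1 v2 : C) (p : pt -> R) (supp : list pt).
Hypothesis Hbasis : lattice_basis v1 v2.
Hypothesis Hlaw : step_law p supp.
Hypothesis Hsph : spherical v1 v2 p supp.
Hypothesis Hirr : irreducible_walk p supp.

Let P := walk p supp.
Let T := lazy P.
Let em := emb v1 v2.

Lemma probP : prob P.
Proof. exact (prob_walk _ _ Hlaw). Qed.

Lemma probT : prob T.
Proof. exact (prob_lazy _ probP). Qed.

Lemma emb_sub z w : em (zsub z w) = (em z - em w)%C.
Proof.
  unfold em, emb, zsub; cbn [fst snd]; rewrite !minus_IZR, !RtoC_minus; ring.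
Qed.

Lemma emb_zero z : em z = RtoC 0 -> z = (0, 0)%Z.
Proof.
  unfold lattice_basis in Hbasis; destruct v1 as [a b], v2 as [c d], z as [m n].
  unfold em, emb, Cplus, Cmult, RtoC; cbn [fst snd]; intros E; injection E; clear E; intros E2 E1.
  simpl in Hbasis.
  assert (E1' : IZR m * a + IZR n * c = 0) by lra.
  assert (E2' : IZR m * b + IZR n * d = 0) by lra.
  assert (IZR m * (a * d - b * c) = 0)
    by (transitivity (d * (IZR m * a + IZR n * c) - c * (IZR m * b + IZR n * d));
        [ring | rewrite E1', E2'; ring]).
  assert (IZR n * (a * d - b * c) = 0)
    by (transitivity (a * (IZR m * b + IZR n * d) - b * (IZR m * a + IZR n * c));
        [ring | rewrite E1', E2'; ring]).
  f_equal; apply eq_IZR; eapply Rmult_eq_reg_r; eauto; lra.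
Qed.

Lemma step_not_all_zero : exists w, In w supp /\ 0 < p w /\ w <> (0, 0)%Z.
Proof.
  destruct (Hirr (1, 0)%Z) as [n Hn].
  destruct Hlaw as (_ & Hp & _).
  assert (H : forall z, 0 < Pn p supp n z ->
    z = (0, 0)%Z \/ exists w, In w supp /\ 0 < p w /\ w <> (0, 0)%Z).
  { apply reachable_ind; auto.
    intros z w Hw Hpw [E|]; auto.
    assert (Dec : {w = (0, 0)%Z} + {w <> (0, 0)%Z}) by (decide equality; apply Z.eq_dec).
    destruct Dec as [->|Hw0]; [rewrite zsub_0_r in E; auto | right; exists w; auto]. }
  destruct (H _ Hn) as [E|]; auto; discriminate.
Qed.

(** With w = x + i y, w^2 has real part x^2 - y^2 and imaginary part 2 x y, so the spherical
    condition says E w^2 = 0. Here sigma = 2 c = E |w|^2, positive because some possible step is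
    nonzero. *)
Lemma moments : exists sigma, sigma <> 0 /\ spherical_moments pt em p supp sigma.
Proof.
  destruct Hsph as (M1 & M2 & c & M11 & M22 & M12).
  assert (Hp := proj1 (proj2 Hlaw)).
  exists (2 * c); split.
  - destruct step_not_all_zero as (w & Hw & Hpw & Hw0) .
    assert (Hem : em w <> RtoC 0) by (intros E; apply Hw0, emb_zero, E).
    assert (Hc : p w * (fst (em w) * fst (em w)) + p w * (snd (em w) * snd (em w)) <= 2 * c).
    { replace (2 * c) with (c + c) by ring; rewrite <- M11 at 1; rewrite <- M22.
      apply Rplus_le_compat.
      - apply (lsum_ge_elem (fun w => p w * (fst (em w) * fst (em w)))); auto.
        intros; apply Rmult_le_pos; auto; nra.
      - apply (lsum_ge_elem (fun w => p w * (snd (em w) * snd (em w)))); auto.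
        intros; apply Rmult_le_pos; auto; nra. }
    assert (0 < fst (em w) * fst (em w) + snd (em w) * snd (em w)); [|nra].
    destruct (Req_dec (fst (em w)) 0) as [E1|E1]; [|nra].
    destruct (Req_dec (snd (em w)) 0) as [E2|E2]; [|nra].
    exfalso; apply Hem; apply C_eq; auto.
  - split; [apply (proj2 (proj2 (proj2 Hlaw)))|].
    fold em in M1, M2, M11, M22, M12.
    repeat split; apply C_eq; rewrite ?Re_csum, ?Im_csum, ?re_RtoC, ?im_RtoC.
    + rewrite <- M1; apply lsum_ext; intros; unfold Re; simpl; ring.
    + rewrite <- M2; apply lsum_ext; intros; unfold Im; simpl; ring.
    + rewrite <- M1; apply lsum_ext; intros; unfold Re; simpl; ring.
    + simpl; transitivity (-1 * lsum (fun w => p w * snd (em w)) supp); [|rewrite M2; ring].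
      rewrite <- lsum_scal; apply lsum_ext; intros; unfold Im; simpl; ring.
    + simpl; transitivity (lsum (fun w => p w * (fst (em w) * fst (em w))) supp
        + -1 * lsum (fun w => p w * (snd (em w) * snd (em w))) supp); [|rewrite M11, M22; ring].
      rewrite <- lsum_scal, <- lsum_plus; apply lsum_ext; intros; unfold Re; simpl; ring.
    + simpl; transitivity (2 * lsum (fun w => p w * (fst (em w) * snd (em w))) supp);
        [|rewrite M12; ring].
      rewrite <- lsum_scal; apply lsum_ext; intros; unfold Im; simpl; ring.
    + simpl; transitivity (lsum (fun w => p w * (fst (em w) * fst (em w))) supp
        + -1 * lsum (fun w => p w * (snd (em w) * snd (em w))) supp); [|rewrite M11, M22; ring].
      rewrite <- lsum_scal, <- lsum_plus; apply lsum_ext; intros; unfold Re; simpl; ring.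
    + simpl; transitivity (-2 * lsum (fun w => p w * (fst (em w) * snd (em w))) supp);
        [|rewrite M12; ring].
      rewrite <- lsum_scal; apply lsum_ext; intros; unfold Im; simpl; ring.
    + simpl; transitivity (lsum (fun w => p w * (fst (em w) * fst (em w))) supp
        + lsum (fun w => p w * (snd (em w) * snd (em w))) supp); [|rewrite M11, M22; ring].
      rewrite <- lsum_plus; apply lsum_ext; intros; unfold Re; simpl; ring.
    + simpl; transitivity (0 * lsum (fun w => p w * (fst (em w) * snd (em w))) supp); [|ring].
      rewrite <- lsum_scal; apply lsum_ext; intros; unfold Im; simpl; ring.
Qed.

(* Two distinct steps exist since the walk is centered and nontrivial. *)
Lemma walk_smoothing : exists x, x <> (0, 0)%Z /\ smoothing P x.
Proof.
  destruct step_not_all_zero as (w & Hw & Hpw & Hw0).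
  destruct (Hlaw) as (_ & Hp & _ & H1).
  assert (H : exists w', In w' supp /\ 0 < p w' /\ w' <> w).
  (* If the mean distance to [w] vanishes, the step is almost surely [w]; being centered, it would
     then be 0. *)
  { destruct (Rle_or_lt (lsum (fun w' => p w' * Cmod (em w' - em w)) supp) 0) as [H0|H0].
    - exfalso; apply Hw0, emb_zero.
      assert (Z : forall w', In w' supp -> p w' * Cmod (em w' - em w) = 0).
      { intros w' Hw'; apply Rle_antisym.
        - eapply Rle_trans; [|exact H0].
          apply (lsum_ge_elem (fun w' => p w' * Cmod (em w' - em w))); auto.
          intros; apply Rmult_le_pos; auto using Cmod_ge_0.
        - apply Rmult_le_pos; auto using Cmod_ge_0. }
      assert (Z' : forall w', In w' supp ->
        p w' * fst (em w') = p w' * fst (em w) /\ p w' * snd (em w') = p w' * snd (em w)).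
      { intros w' Hw'; destruct (Rmult_integral _ _ (Z w' Hw')) as [E|E]; [rewrite E; lra|].
        apply Cmod_eq_0 in E.
        replace (em w') with (em w' - em w + em w)%C by ring; rewrite E; simpl; split; ring. }
      destruct Hsph as (M1 & M2 & _); fold em in M1, M2.
      rewrite (lsum_ext _ (fun w' => fst (em w) * p w')) in M1
        by (intros w' Hw'; rewrite (proj1 (Z' w' Hw')); ring).
      rewrite (lsum_ext _ (fun w' => snd (em w) * p w')) in M2
        by (intros w' Hw'; rewrite (proj2 (Z' w' Hw')); ring).
      rewrite lsum_scal, H1 in M1, M2.
      apply C_eq; [change (fst (em w) = 0) | change (snd (em w) = 0)]; lra.
    - destruct (lsum_pos_ex _ _ H0) as (w' & Hw' & Hpos); exists w'; split; auto.
      assert (A := Hp w'); split.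
      + destruct A as [|A]; auto; rewrite <- A in Hpos; lra.
      + intros ->; replace (em w - em w)%C with (RtoC 0) in Hpos by ring.
        rewrite Cmod_0 in Hpos; lra. }
  destruct H as (w' & Hw' & Hpw' & Hne).
  exists (zsub w' w); split.
  - intros E; apply Hne; destruct w, w'; unfold zsub in E; simpl in E; injection E; intros.
    f_equal; lia.
  - apply (grad_iter_bound P w w' (p w) (p w')); auto using probP.
    + apply in_map_iff; exists w; auto.
    + apply in_map_iff; exists w'; auto.
Qed.

(** Cramer's rule: the determinant [d] of the basis recovers the integer coordinates from the
    point. *)
Lemma emb_wt : exists kappa, 1 <= kappa /\
  (forall z, Cmod (em z) <= kappa * wt z) /\ (forall z, wt z <= kappa * (1 + Cmod (em z))).
Proof.
  set (d := fst v1 * snd v2 - snd v1 * fst v2); assert (Hd : d <> 0) by exact Hbasis.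
  set (S := Cmod v1 + Cmod v2).
  assert (A1 := Cmod_ge_0 v1); assert (A2 := Cmod_ge_0 v2).
  assert (Dp : 0 < Rabs d) by now apply Rabs_pos_lt.
  assert (Kp : 0 <= 2 * S / Rabs d) by (apply Rdiv_le_0_compat; unfold S; lra).
  exists (1 + S + 2 * S / Rabs d); split; [unfold S in *; lra|]; split; intros z.
  - unfold em, emb; eapply Rle_trans; [apply Cmod_triangle|].
    rewrite !Cmod_mult, !Cmod_R.
    assert (B1 := Rabs_pos (IZR (fst z))); assert (B2 := Rabs_pos (IZR (snd z))).
    apply Rle_trans with (S * wt z).
    + unfold S, wt; nra.
    + apply Rmult_le_compat_r; [apply Rlt_le, wt_pos | lra].
  - assert (Hco : forall (n : Z) (x : R) (v : C), IZR n * d = x -> Rabs x <= 2 * Cmod v * Cmod (em z) ->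
        Rabs (IZR n) <= 2 * Cmod v / Rabs d * Cmod (em z)).
    { intros n x v E Hx; apply Rmult_le_reg_r with (Rabs d); auto.
      rewrite <- Rabs_mult, E; eapply Rle_trans; [exact Hx|].
      apply Req_le; field; lra. }
    assert (Hcr : forall a b : C, Rabs (fst a * snd b - snd a * fst b) <= 2 * Cmod b * Cmod a).
    { intros a b; eapply Rle_trans; [apply Rabs_triang|]; rewrite Rabs_Ropp, !Rabs_mult.
      assert (X := Rmax_Cmod a); assert (Y := Rmax_Cmod b).
      assert (X1 := Rmax_l (Rabs (fst a)) (Rabs (snd a))).
      assert (X2 := Rmax_r (Rabs (fst a)) (Rabs (snd a))).
      assert (Y1 := Rmax_l (Rabs (fst b)) (Rabs (snd b))).
      assert (Y2 := Rmax_r (Rabs (fst b)) (Rabs (snd b))).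
      replace (2 * Cmod b * Cmod a) with (Cmod a * Cmod b + Cmod a * Cmod b) by ring.
      apply Rplus_le_compat; apply Rmult_le_compat; auto using Rabs_pos; lra. }
    assert (E1 : IZR (fst z) * d = fst (em z) * snd v2 - snd (em z) * fst v2)
      by (unfold d, em, emb; simpl; ring).
    assert (E2 : IZR (snd z) * d = - (fst (em z) * snd v1 - snd (em z) * fst v1))
      by (unfold d, em, emb; simpl; ring).
    assert (F1 := Hco _ _ v2 E1 (Hcr (em z) v2)).
    assert (F2 := Hco _ _ v1 E2 ltac:(rewrite Rabs_Ropp; apply Hcr)).
    unfold wt; assert (A3 := Cmod_ge_0 (em z)).
    replace (2 * S / Rabs d) with (2 * Cmod v1 / Rabs d + 2 * Cmod v2 / Rabs d) in *
      by (unfold S; field; lra).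
    unfold S in *; nra.
Qed.

(** Lattice points of bounded modulus form a finite set, so the constant can absorb the values of
    [f] there. *)
Lemma Decay_of_large N f (B M : R) :
  (forall z, M <= Cmod (em z) -> Rabs (f z) <= B / Cmod (em z) ^ N) -> Decay N f.
Proof.
  intros H; destruct emb_wt as (kappa & Hk & _ & Hw).
  set (M' := Rmax M 1).
  destruct (in_box_wt (kappa * (1 + M'))) as [k Hbox].
  set (S := lsum (fun z => Rabs (f z)) (box k)).
  assert (HS : 0 <= S) by (apply lsum_nonneg; intros; apply Rabs_pos).
  assert (M1 : 1 <= M') by apply Rmax_r.
  exists (Rabs B * (2 * kappa) ^ N + S * (kappa * (1 + M')) ^ N); intros z.
  assert (Wp := wt_pow_pos z N).
  assert (A := Rabs_pos B).
  assert (P1 : 0 <= (2 * kappa) ^ N) by (apply pow_le; lra).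
  assert (P2 : 0 <= (kappa * (1 + M')) ^ N) by (apply pow_le; nra).
  apply Rmult_le_reg_r with (wt z ^ N); auto.
  unfold Rdiv; rewrite (Rmult_assoc _ (/ wt z ^ N)), Rinv_l, Rmult_1_r by lra.
  destruct (Rle_or_lt M' (Cmod (em z))) as [Hz|Hz].
  - assert (Cp : 0 < Cmod (em z) ^ N) by (apply pow_lt; lra).
    assert (Hle : wt z ^ N <= (2 * kappa) ^ N * Cmod (em z) ^ N).
    { rewrite <- Rpow_mult_distr; apply pow_incr; split; [apply Rlt_le, wt_pos|].
      eapply Rle_trans; [apply Hw|]; nra. }
    assert (Hf : Rabs (f z) <= Rabs B / Cmod (em z) ^ N).
    { eapply Rle_trans; [apply H; eapply Rle_trans; [apply Rmax_l | exact Hz]|].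
      apply Rmult_le_compat_r; [apply Rlt_le, Rinv_0_lt_compat; auto | apply Rle_abs]. }
    apply Rle_trans with (Rabs B * (2 * kappa) ^ N); [|nra].
    apply Rle_trans with (Rabs B / Cmod (em z) ^ N * ((2 * kappa) ^ N * Cmod (em z) ^ N)).
    + apply Rmult_le_compat; auto using Rabs_pos; lra.
    + apply Req_le; field; lra.
  - assert (Hwz : wt z <= kappa * (1 + M')).
    { eapply Rle_trans; [apply Hw|]; apply Rmult_le_compat_l; lra. }
    assert (Hf : Rabs (f z) <= S).
    { apply (lsum_ge_elem (fun z => Rabs (f z))); auto; intros; apply Rabs_pos. }
    assert (Hle : wt z ^ N <= (kappa * (1 + M')) ^ N)
      by (apply pow_incr; split; [apply Rlt_le, wt_pos | auto]).
    apply Rle_trans with (S * (kappa * (1 + M')) ^ N); [|nra].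
    apply Rmult_le_compat; auto using Rabs_pos; lra.
Qed.

Lemma ravg_walk f z : ravg pt em p supp f (em z) = act P (fun z => f (em z)) z.
Proof.
  unfold ravg, P; rewrite act_walk; apply lsum_ext; intros; now rewrite emb_sub.
Qed.

Lemma iter_decay_T m f : (1 <= m)%nat -> Diff 0 m f ->
  exists C, 0 <= C /\ forall n z, Rabs (Nat.iter n (act T) f z) <= C / sqrt (INR n + 1) ^ m.
Proof.
  intros Hm Hf.
  destruct (iter_decay T probT (lazy_smoothing p supp e1 Hlaw Hirr)
    (lazy_smoothing p supp e2 Hlaw Hirr) m f Hf) as (C & HC & HB).
  assert (Mp : 0 < INR m) by (apply lt_0_INR; lia).
  exists (C * sqrt (INR m) ^ m); split; [apply Rmult_le_pos; auto; apply pow_le, sqrt_pos|].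
  (* Blocks of length n / m; n + 1 <= m (n / m + 1) accounts for the factor sqrt(m)^m. *)
  intros n z; eapply Rle_trans; [apply (HB (n / m)%nat)|].
  - apply Nat.Div0.mul_div_le.
  - assert (Np := pos_INR n); assert (Kp := pos_INR (n / m)).
    assert (S1 : 0 < sqrt (INR n + 1)) by (apply sqrt_lt_R0; lra).
    assert (S2 : 0 < sqrt (INR (n / m) + 1)) by (apply sqrt_lt_R0; lra).
    assert (Q1 : 0 < sqrt (INR n + 1) ^ m) by now apply pow_lt.
    assert (Q2 : 0 < sqrt (INR (n / m) + 1) ^ m) by now apply pow_lt.
    assert (Hle : sqrt (INR n + 1) ^ m <= sqrt (INR m) ^ m * sqrt (INR (n / m) + 1) ^ m).
    { rewrite <- Rpow_mult_distr; apply pow_incr; split; [lra|].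
      rewrite <- sqrt_mult by lra; apply sqrt_le_1_alt.
      rewrite <- !S_INR, <- mult_INR; apply le_INR.
      assert (E := Nat.mul_succ_div_gt n m ltac:(lia)); lia. }
    apply Rmult_le_reg_r with (sqrt (INR n + 1) ^ m); auto.
    unfold Rdiv; rewrite (Rmult_assoc _ (/ sqrt (INR n + 1) ^ m)), Rinv_l, Rmult_1_r by lra.
    apply Rle_trans with (C * / sqrt (INR (n / m) + 1) ^ m *
      (sqrt (INR m) ^ m * sqrt (INR (n / m) + 1) ^ m)).
    + apply Rmult_le_compat_l; auto; apply Rmult_le_pos; auto; now apply Rlt_le, Rinv_0_lt_compat.
    + apply Req_le; field; lra.
Qed.

(** Integral comparison in telescoping form: 1 / y^3 <= 2 / x - 2 / y when y^2 = x^2 + 1. The first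
    term 1 = 3 - 2 fixes the constant. *)
Lemma sum_pow_three_halves n :
  sum_n (fun k => / sqrt (INR k + 1) ^ 3) n <= 3 - 2 / sqrt (INR n + 1).
Proof.
  induction n as [|n IH].
  - rewrite sum_O; simpl INR; rewrite Rplus_0_l, sqrt_1; lra.
  - rewrite sum_Sn_R, S_INR.
    assert (A := pos_INR n).
    assert (Hp : 0 < sqrt (INR n + 1)) by (apply sqrt_lt_R0; lra).
    assert (Hpq : sqrt (INR n + 1) <= sqrt (INR n + 1 + 1)) by (apply sqrt_le_1_alt; lra).
    assert (Hpp := sqrt_sqrt (INR n + 1) ltac:(lra)).
    assert (Hqq := sqrt_sqrt (INR n + 1 + 1) ltac:(lra)).
    set (x := sqrt (INR n + 1)) in *; set (y := sqrt (INR n + 1 + 1)) in *.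
    assert (/ y ^ 3 <= 2 / x - 2 / y).
    { replace (2 / x - 2 / y) with (2 * (y * y - x * x) / (x * y * (x + y))) by (field; lra).
      replace (y * y - x * x) with 1 by lra.
      replace (2 * 1 / (x * y * (x + y))) with (/ (x * y * ((x + y) / 2))) by (field; lra).
      apply Rinv_le_contravar.
      - repeat apply Rmult_lt_0_compat; lra.
      - replace (y ^ 3) with (y * y * y) by ring.
        apply Rmult_le_compat; try lra; [nra|].
        apply Rmult_le_compat_r; lra. }
    simpl in *; lra.
Qed.

(* Otherwise [T^n G (0)] would stay bounded, although [G] tends to infinity and the lazy
   walk escapes from every finite set. *)
Lemma flux_nonzero Q s N g : Span 1 Q -> (8 <= N)%nat ->
  g = (fun z => act P (fun z => green Q (em z)) z - green Q (em z)) ->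
  Diff N 1 (fun z => g z - s * delta z) -> s <> 0.
Proof.
  intros HQ HN Eg HI ->.
  set (G := fun z => green Q (em z)) in *.
  replace (fun z => g z - 0 * delta z) with g in HI by (extensionality z; ring).
  (* Decaying potentials are already second differences, so with s = 0 [g] is a sum of third ones.
     That gives the summable rate n^(-3/2), where two differences would give only 1 / n. *)
  assert (H3 : Diff 0 3 g).
  { destruct HI as (f1 & f2 & H1 & H2 & ->); apply Diff_plus.
    - apply Diff_grad1, Decay_Diff_0_2, (Decay_le N); auto.
    - apply Diff_grad2, Decay_Diff_0_2, (Decay_le N); auto. }
  destruct (iter_decay_T 3 g ltac:(lia) H3) as (C & HC & HB).
  assert (Hsum : forall n, Nat.iter (S n) (act T) G (0, 0)%Z
     = G (0, 0)%Z + / 2 * sum_n (fun k => Nat.iter k (act T) g (0, 0)%Z) n).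
  { assert (Hstep : forall n, Nat.iter (S n) (act T) G =
      fun z => Nat.iter n (act T) G z + / 2 * Nat.iter n (act T) g z).
    { intros n; transitivity (Nat.iter n (act T) (fun z => G z + / 2 * g z)).
      - rewrite Nat.iter_succ_r; f_equal.
        extensionality z; unfold T; rewrite act_lazy, Eg; fold G.
        change (green Q (em z)) with (G z); field.
      - rewrite (iter_plus T n G (fun z => / 2 * g z)), iter_scal; reflexivity. }
    induction n as [|n IH].
    - rewrite Hstep, sum_O; reflexivity.
    - rewrite Hstep, IH, sum_Sn_R; ring. }
  assert (Hbd : forall n, Nat.iter (S n) (act T) G (0, 0)%Z <= G (0, 0)%Z + 2 * C).
  { intros n; rewrite Hsum.
    assert (A : sum_n (fun k => Nat.iter k (act T) g (0, 0)%Z) n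
       <= C * sum_n (fun k => / sqrt (INR k + 1) ^ 3) n).
    { rewrite <- (sum_n_mult_l (K := R_AbsRing) C).
      apply sum_n_m_le; intros k; eapply Rle_trans; [apply Rle_abs | apply HB]. }
    assert (B := sum_pow_three_halves n).
    assert (0 < 2 / sqrt (INR n + 1)).
    { apply Rdiv_lt_0_compat; [lra|]; apply sqrt_lt_R0; assert (X := pos_INR n); lra. }
    nra. }
  (* One unit above the bound on the iterates. The finite box where G < [Lam] is possible will cost
     at most 1/2, which contradicts that bound. *)
  set (Lam := G (0, 0)%Z + 2 * C + 1) in *.
  destruct (Span_bigO 1 Q HQ) as (B & M & HM & HQB).
  destruct emb_wt as (kappa & Hk & Hw & Hw').
  set (M' := Rmax M (exp (Lam + Rabs B))).
  destruct (in_box_wt (kappa * (1 + M'))) as [k Hbox].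
  set (c := lsum (fun z => Rabs (G z)) (box k) + Rabs Lam).
  assert (Hc : 0 <= c).
  { apply Rplus_le_le_0_compat; [apply lsum_nonneg; intros|]; apply Rabs_pos. }
  assert (HG : forall z, Lam + (- c) * boxind k z <= G z).
  { intros z; assert (A := boxind_nonneg k z).
    destruct (Rle_or_lt M' (Cmod (em z))) as [Hz|Hz].
    - assert (Hz1 : M <= Cmod (em z)) by (eapply Rle_trans; [apply Rmax_l | exact Hz]).
      assert (Hz2 : exp (Lam + Rabs B) <= Cmod (em z))
        by (eapply Rle_trans; [apply Rmax_r | exact Hz]).
      assert (Hln : Lam + Rabs B <= ln (Cmod (em z))).
      { rewrite <- (ln_exp (Lam + Rabs B)).
        destruct Hz2 as [Hz2|<-]; [|lra]; apply Rlt_le, ln_increasing; auto; apply exp_pos. }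
      assert (HR : Rabs (Re (Q (em z))) <= Rabs B).
      { eapply Rle_trans; [apply re_le_Cmod|]; eapply Rle_trans; [now apply HQB|].
        rewrite pow_1; apply Rle_trans with (Rabs B / 1).
        - unfold Rdiv; apply Rle_trans with (Rabs B * / Cmod (em z)).
          + apply Rmult_le_compat_r; [apply Rlt_le, Rinv_0_lt_compat; lra | apply Rle_abs].
          + apply Rmult_le_compat_l; [apply Rabs_pos | apply Rinv_le_contravar; lra].
        - unfold Rdiv; lra. }
      assert (HR' := Rle_abs (- Re (Q (em z)))); rewrite Rabs_Ropp in HR'.
      unfold G, green; nra.
    - assert (Hin : In z (box k)).
      { apply Hbox; eapply Rle_trans; [apply Hw'|]; apply Rmult_le_compat_l; lra. }
      assert (A1 := boxind_ge1 k z Hin).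
      assert (HGz := lsum_ge_elem (fun z => Rabs (G z)) (box k) z
        (fun y _ => Rabs_pos (G y)) Hin); cbv beta in HGz.
      assert (X := Rle_abs (- G z)); rewrite Rabs_Ropp in X.
      assert (Y := Rle_abs Lam).
      assert (c <= c * boxind k z) by nra.
      unfold c in *; lra. }
  destruct (iter_boxind_small T e1 k (/ (2 * (c + 1))) probT
    (lazy_smoothing p supp e1 Hlaw Hirr) ltac:(discriminate)) as [n0 Hn0].
  { apply Rinv_0_lt_compat; lra. }
  specialize (Hn0 (S n0) (0, 0)%Z ltac:(lia)); specialize (Hbd n0).
  assert (Hfin := iter_le T (S n0) _ _ probT HG (0, 0)%Z).
  rewrite (iter_plus T (S n0) (fun _ => Lam)), iter_scal, iter_const in Hfin by apply probT.
  assert (Hs : c * Nat.iter (S n0) (act T) (boxind k) (0, 0)%Z <= / 2).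
  { apply Rle_trans with (c * / (2 * (c + 1))); [now apply Rmult_le_compat_l|].
    apply Rmult_le_reg_r with (2 * (c + 1)); [lra|].
    rewrite Rmult_assoc, Rinv_l by lra; lra. }
  unfold Lam in *; lra.
Qed.

(** * The Poisson equation and the fundamental solution *)

Lemma act_Series mu (a : nat -> pt -> R) z : (forall z, ex_series (fun n => a n z)) ->
  ex_series (fun n => act mu (a n) z) /\
  act mu (fun z => Series (fun n => a n z)) z = Series (fun n => act mu (a n) z).
Proof.
  intros H; induction mu as [|[c w] mu [IH1 IH2]].
  - assert (E0 : ex_series (fun _ : nat => 0)).
    { exists 0; apply (is_lim_seq_ext (fun _ => 0) _ 0); [|apply is_lim_seq_const].
      intros n; rewrite sum_n_const; ring. }
    split; [exact E0|].
    change (0 = Series (fun _ : nat => 0)).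
    rewrite (Series_ext _ (fun _ => 0 * 0)) by (intros; ring).
    rewrite Series_scal_l; ring.
  - assert (E1 : ex_series (fun n => c * a n (zsub z w)))
      by (apply (ex_series_scal (K := R_AbsRing) (V := R_NormedModule) c
            (fun n => a n (zsub z w))), H).
    split.
    + apply (ex_series_plus (K := R_AbsRing) (V := R_NormedModule)
        (fun n => c * a n (zsub z w)) (fun n => act mu (a n) z)); auto.
    + rewrite act_cons, IH2, <- Series_scal_l, <- Series_plus; auto.
Qed.

(* For [n] large compared to [wt z] smoothing wins; otherwise finite propagation speed
   leaves only values of [f] far from the origin. *)
Lemma heat_flow_bound K f : Decay (K + 2) f -> Diff 0 (2 * K + 4) f ->
  exists C, 0 <= C /\ forall n z,
    Rabs (Nat.iter n (act T) f z) <= C / wt z ^ K * / (INR n + 1) ^ 2.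
Proof.
  intros [C2 HC2] HI; assert (C20 := Decay_cst_nonneg _ _ _ HC2).
  destruct (iter_decay_T (2 * K + 4) f ltac:(lia) HI) as (C1 & HC1 & HB1).
  set (L := lsum (fun cw => wt (snd cw)) T).
  assert (HL0 : 0 <= L) by (apply lsum_nonneg; intros; apply Rlt_le, wt_pos).
  assert (HL : forall cw, In cw T -> wt (snd cw) - 1 <= L).
  { intros cw Hcw.
    assert (A := lsum_ge_elem (fun cw : R * pt => wt (snd cw)) T cw
      (fun y _ => Rlt_le _ _ (wt_pos (snd y))) Hcw); cbv beta in A.
    unfold L; lra. }
  (* If wt z > R0 (n + 1), then n steps of length at most L still leave weight at least wt z / 2. *)
  set (R0 := 2 * L + 1).
  exists (C1 * R0 ^ K + C2 * 2 ^ (K + 2)).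
  assert (Q1 : 0 <= R0 ^ K) by (apply pow_le; unfold R0; lra).
  assert (Q2 : 0 <= 2 ^ (K + 2)) by (apply pow_le; lra).
  split; [apply Rplus_le_le_0_compat; now apply Rmult_le_pos|].
  intros n z.
  assert (Np := pos_INR n); assert (W := wt_pos z).
  set (m := INR n + 1) in *; assert (Hm : 1 <= m) by (unfold m; lra).
  assert (WK : 0 < wt z ^ K) by now apply pow_lt.
  assert (MK : 0 < m ^ K) by (apply pow_lt; lra).
  assert (M2 : 0 < m ^ 2) by (apply pow_lt; lra).
  set (Z0 := / wt z ^ K * / m ^ 2).
  assert (HZ0 : 0 < Z0) by (apply Rmult_lt_0_compat; now apply Rinv_0_lt_compat).
  replace ((C1 * R0 ^ K + C2 * 2 ^ (K + 2)) / wt z ^ K * / m ^ 2)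
    with (C1 * R0 ^ K * Z0 + C2 * 2 ^ (K + 2) * Z0) by (unfold Z0; field; lra).
  assert (T1 : 0 <= C1 * R0 ^ K * Z0) by (apply Rmult_le_pos; [now apply Rmult_le_pos | lra]).
  assert (T2 : 0 <= C2 * 2 ^ (K + 2) * Z0) by (apply Rmult_le_pos; [now apply Rmult_le_pos | lra]).
  destruct (Rle_or_lt (wt z) (R0 * m)) as [Hz|Hz].
  - apply Rle_trans with (C1 * R0 ^ K * Z0); [|lra].
    eapply Rle_trans; [apply HB1|]; fold m.
    (* The 2 K + 4 half powers of n + 1 split into K powers traded for wt z and two kept for the sum
       over n. *)
    replace (2 * K + 4)%nat with (2 * (K + 2))%nat by lia.
    rewrite pow_mult, pow2_sqrt by lra.
    unfold Rdiv; rewrite Rmult_assoc; apply Rmult_le_compat_l; auto.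
    rewrite pow_add, Rinv_mult; unfold Z0; rewrite <- Rmult_assoc.
    apply Rmult_le_compat_r; [now apply Rlt_le, Rinv_0_lt_compat|].
    apply Rmult_le_reg_r with (m ^ K * wt z ^ K); [now apply Rmult_lt_0_compat|].
    replace (/ m ^ K * (m ^ K * wt z ^ K)) with (wt z ^ K) by (field; lra).
    replace (R0 ^ K * / wt z ^ K * (m ^ K * wt z ^ K)) with (R0 ^ K * m ^ K) by (field; lra).
    rewrite <- Rpow_mult_distr; apply pow_incr; lra.
  - apply Rle_trans with (C2 * 2 ^ (K + 2) * Z0); [|lra].
    assert (HLn : L * INR n <= wt z / 2) by (unfold R0, m in *; nra).
    apply (iter_local T n f probT L HL0 HL); intros x Hx.
    assert (Wx : 0 < wt x) by apply wt_pos.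
    eapply Rle_trans; [apply HC2|].
    unfold Rdiv; rewrite Rmult_assoc; apply Rmult_le_compat_l; auto.
    apply Rle_trans with (/ (wt z / 2) ^ (K + 2)).
    + apply Rinv_le_contravar; [apply pow_lt; lra | apply pow_incr; lra].
    + unfold Rdiv; rewrite Rpow_mult_distr, (pow_inv 2), Rinv_mult, Rinv_inv, Rmult_comm.
      apply Rmult_le_compat_l; auto.
      rewrite pow_add, Rinv_mult; unfold Z0.
      apply Rmult_le_compat_l; [now apply Rlt_le, Rinv_0_lt_compat|].
      apply Rinv_le_contravar; auto; apply pow_incr; unfold R0 in *; nra.
Qed.

(** Neumann series: H = sum of T^n f satisfies T H = H - f, and T H = (H + P H) / 2 turns this into
    the factor -2. *)
Lemma poisson_solution K f : Decay (K + 2) f -> Diff 0 (2 * K + 4) f ->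
  exists H, Decay K H /\ forall z, act P H z - H z = - 2 * f z.
Proof.
  intros HD HI; destruct (heat_flow_bound K f HD HI) as (C & HC & HB).
  exists (fun z => Series (fun n => Nat.iter n (act T) f z)); split.
  - exists (C * Series (fun j => / (INR j + 1) ^ 2)); intros z.
    eapply Rle_trans; [apply (series_inv_sq_bound _ _ (fun n => HB n z))|].
    apply Req_le; unfold Rdiv; ring.
  - intros z.
    assert (Hex : forall z, ex_series (fun n => Nat.iter n (act T) f z))
      by (intros y; apply (series_inv_sq_bound _ _ (fun n => HB n y))).
    set (H := fun z => Series (fun n => Nat.iter n (act T) f z)).
    assert (E : act T H z = Series (fun n => Nat.iter (S n) (act T) f z))
      by exact (proj2 (act_Series T _ z Hex)).
    unfold T at 1 in E; rewrite act_lazy in E.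
    assert (E' : H z = f z + Series (fun n => Nat.iter (S n) (act T) f z))
      by exact (Series_incr_1 _ (Hex z)).
    change (act P H z - H z = -2 * f z); lra.
Qed.

Lemma fundamental_solution K : exists (A : pt -> R) (alpha : R) (Q : C -> C),
  (forall z, act P A z - A z = delta z) /\ Span 1 Q /\
  exists B M : R, 1 <= M /\ forall z, M <= Cmod (em z) ->
    Rabs (A z - (alpha * ln (Cmod (em z)) + Re (Q (em z)))) <= B / Cmod (em z) ^ K.
Proof.
  destruct moments as (sigma & Hs & Hmom).
  (* [heat_flow_bound] needs 2 K + 4 differences for decay of order K; each costs four powers in
     [Diff_lift], and four more go into extracting [s]. *)
  set (m := (2 * K + 4)%nat); set (N := (K + 2 + 4 * m)%nat).
  destruct (green_exists pt em p supp sigma Hmom Hs (N + 4)) as (Q & HQ & B & M & HM & HB).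
  set (G := fun z => green Q (em z)).
  set (g := fun z => act P G z - G z).
  assert (HDg : Decay (N + 4) g).
  { apply (Decay_of_large _ _ B M); intros z Hz; unfold g.
    assert (E : act P G z = ravg pt em p supp (green Q) (em z)) by (symmetry; apply ravg_walk).
    rewrite E; now apply HB. }
  destruct (Decay_split N g HDg) as [s HI].
  assert (Hs0 : s <> 0).
  { apply (flux_nonzero Q s N g); auto; unfold N, m; lia. }
  destruct (Diff_lift (/ s) g m (K + 2) delta) as [nu Hnu].
  - apply (Decay_of_large _ _ 0 1); intros z Hz.
    replace (delta z) with 0; [rewrite Rabs_R0; unfold Rdiv; lra|].
    unfold delta; destruct z as [a b]; simpl.
    destruct (Z.eqb_spec a 0) as [->|], (Z.eqb_spec b 0) as [->|]; simpl; auto.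
    exfalso; unfold em, emb in Hz; simpl in Hz.
    replace (0 * v1 + 0 * v2)%C with (RtoC 0) in Hz by ring; rewrite Cmod_0 in Hz; lra.
  - fold N; replace (fun z => delta z - / s * g z) with
      (fun z => (- / s) * (g z - s * delta z)) by (extensionality z; field; auto).
    now apply (Diff_scal N 1).
  - set (f := fun z => delta z - act nu g z) in *.
    destruct (poisson_solution K f) as (H & HDH & HH).
    { eapply Diff_Decay; eauto. }
    { eapply Diff_le; [|exact Hnu]; lia. }
    (* A translate of the Green function is still ln |z| plus negative powers, so the total mass of
       [nu] is the coefficient of the logarithm. *)
    set (alpha := lsum fst nu).
    assert (HR : RExp K 1 (fun z => lsum (fun cw => fst cw *
       (green Q (z - em (snd cw))%C - ln (Cmod z))) nu)).
    { apply (RExp_lsum K 1 (fun (cw : R * pt) z => fst cw *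
       (green Q (z - em (snd cw))%C - ln (Cmod z)))).
      intros cw; apply RExp_scal, RExp_green_shift; auto. }
    destruct HR as (Q' & HQ' & B1 & M1 & HM1 & HB1).
    destruct HDH as [C HC]; assert (C0 := Decay_cst_nonneg _ _ _ HC).
    destruct emb_wt as (kappa & Hk & Hw & _).
    (* P - 1 maps the first summand to act nu g and the second to f = delta - act nu g. *)
    exists (fun z => act nu G z + (- / 2) * H z), alpha, Q'; split; [|split; auto].
    + intros z; rewrite act_plus, act_scal, act_comm.
      specialize (HH z); unfold f, g in HH; rewrite act_minus in HH.
      lra.
    + exists (B1 + C * kappa ^ K), M1; split; auto; intros z Hz.
      specialize (HB1 (em z) Hz).
      assert (E : lsum (fun cw => fst cw * (green Q (em z - em (snd cw))%C - ln (Cmod (em z)))) nu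
        = act nu G z - alpha * ln (Cmod (em z))).
      { rewrite (lsum_ext _ (fun cw => fst cw * G (zsub z (snd cw))
           + (- ln (Cmod (em z))) * fst cw)).
        - rewrite lsum_plus, lsum_scal; unfold act, alpha; ring.
        - intros cw _; unfold G; rewrite emb_sub; ring. }
      rewrite E in HB1.
      replace (act nu G z + - / 2 * H z - (alpha * ln (Cmod (em z)) + Re (Q' (em z)))) with
        ((act nu G z - alpha * ln (Cmod (em z)) - Re (Q' (em z))) + - / 2 * H z) by ring.
      eapply Rle_trans; [apply Rabs_triang|].
      unfold Rdiv; rewrite Rmult_plus_distr_r; apply Rplus_le_compat; auto.
      assert (Cp : 0 < Cmod (em z) ^ K) by (apply pow_lt; lra).
      assert (Wp := wt_pow_pos z K).
      rewrite Rabs_mult, Rabs_Ropp, Rabs_pos_eq by lra.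
      apply Rle_trans with (C / wt z ^ K).
      { specialize (HC z); assert (X := Rabs_pos (H z)); lra. }
      unfold Rdiv; rewrite Rmult_assoc; apply Rmult_le_compat_l; auto.
      apply Rmult_le_reg_r with (wt z ^ K * Cmod (em z) ^ K); [now apply Rmult_lt_0_compat|].
      replace (/ wt z ^ K * (wt z ^ K * Cmod (em z) ^ K)) with (Cmod (em z) ^ K) by (field; lra).
      replace (kappa ^ K * / Cmod (em z) ^ K * (wt z ^ K * Cmod (em z) ^ K)) with
        (kappa ^ K * wt z ^ K) by (field; lra).
      rewrite <- Rpow_mult_distr; apply pow_incr; split; [lra | apply Hw].
Qed.

(** * Identification with the harmonic potential *)

Lemma grad_log_Decay1 A alpha v (B M : R) : 1 <= M ->
  (forall z, M <= Cmod (em z) -> Rabs (A z - alpha * ln (Cmod (em z))) <= B / Cmod (em z)) ->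
  Decay 1 (act (grad v) A).
Proof.
  intros HM HB.
  destruct (RExp_ln_shift 1 (em v)) as (P0 & HP0 & B1 & M1 & HM1 & HB1).
  destruct (Span_bigO 1 P0 HP0) as (B2 & M2 & HM2 & HB2).
  assert (V := Cmod_ge_0 (em v)).
  (* The threshold contains 2 M and 2 |v| so that |z - v| >= |z| / 2 >= M. *)
  apply (Decay_of_large _ _ (Rabs alpha * (B1 + B2) + (Rabs B + 2 * Rabs B))
    (2 * M + 2 * Cmod (em v) + M1 + M2)); intros z Hz.
  assert (Hz0 : M <= Cmod (em z)) by lra.
  assert (Hzv : Cmod (em z) / 2 <= Cmod (em (zsub z v))).
  { rewrite emb_sub; assert (A0 := Cmod_triangle (em z - em v) (em v)).
    replace (em z - em v + em v)%C with (em z) in A0 by ring; lra. }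
  assert (Hz1 : M <= Cmod (em (zsub z v))) by lra.
  assert (X1 := HB z Hz0); assert (X2 := HB (zsub z v) Hz1).
  specialize (HB1 (em z) ltac:(lra)); specialize (HB2 (em z) ltac:(lra)).
  assert (HB3 := re_le_Cmod (P0 (em z))).
  rewrite grad_eq, pow_1 in *; rewrite emb_sub in *.
  set (r := Cmod (em z)) in *; set (r' := Cmod (em z - em v)%C) in *.
  assert (X3 : Rabs (ln r' - ln r) <= (B1 + B2) / r).
  { replace (ln r' - ln r) with ((ln r' - ln r - Re (P0 (em z))) + Re (P0 (em z))) by ring.
    eapply Rle_trans; [apply Rabs_triang|]; unfold Rdiv in *; lra. }
  assert (Rp : 0 < / r) by (apply Rinv_0_lt_compat; lra).
  assert (X1' : Rabs (A z - alpha * ln r) <= Rabs B / r).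
  { eapply Rle_trans; [exact X1|]; apply Rmult_le_compat_r; [lra | apply Rle_abs]. }
  assert (X2' : Rabs (A (zsub z v) - alpha * ln r') <= 2 * Rabs B / r).
  { eapply Rle_trans; [exact X2|].
    apply Rle_trans with (Rabs B / r').
    - apply Rmult_le_compat_r; [apply Rlt_le, Rinv_0_lt_compat; lra | apply Rle_abs].
    - replace (2 * Rabs B / r) with (Rabs B * / (r / 2)) by (field; lra).
      apply Rmult_le_compat_l; [apply Rabs_pos | apply Rinv_le_contravar; lra]. }
  replace (A z - A (zsub z v)) with
    ((- alpha) * (ln r' - ln r) + ((A z - alpha * ln r) - (A (zsub z v) - alpha * ln r'))) by ring.
  eapply Rle_trans; [apply Rabs_triang|].
  rewrite Rabs_mult, Rabs_Ropp.
  unfold Rdiv; rewrite Rmult_plus_distr_r; apply Rplus_le_compat.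
  - rewrite Rmult_assoc; apply Rmult_le_compat_l; [apply Rabs_pos | exact X3].
  - eapply Rle_trans; [apply Rabs_triang|]; rewrite Rabs_Ropp; unfold Rdiv in *; lra.
Qed.

Lemma harm_pot_fundamental A : (forall z, act P A z - A z = delta z) ->
  (forall v, Decay 1 (act (grad v) A)) ->
  forall z, harm_pot p supp z = A z - A (0, 0)%Z.
Proof.
  intros HA HD z; unfold harm_pot.
  destruct walk_smoothing as (x & Hx & HS).
  (* v = -z, so the difference in direction [v], taken at the origin, compares 0 with z. *)
  set (v := zsub (0, 0)%Z z).
  assert (Hstep : forall n y, Pn p supp n y =
    Nat.iter (S n) (act P) A y - Nat.iter n (act P) A y).
  { intros n y; rewrite Pn_iter; fold P; rewrite Nat.iter_succ_r.
    replace delta with (fun z => act P A z + (-1) * A z)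
      by (extensionality u; rewrite <- HA; ring).
    rewrite iter_plus, iter_scal; ring. }
  (* [sum_n] runs over k = 0, ..., n, so n + 1 iterations are left after telescoping. *)
  assert (Hsum : forall n, A z - A (0, 0)%Z + Nat.iter (S n) (act P) (act (grad v) A) (0, 0)%Z =
    sum_n (fun k => Pn p supp k (0, 0)%Z - Pn p supp k z) n).
  { assert (Hg : forall n, Nat.iter n (act P) (act (grad v) A) (0, 0)%Z =
      Nat.iter n (act P) A (0, 0)%Z - Nat.iter n (act P) A z).
    { intros n; rewrite <- act_iter_comm, grad_eq.
      replace (zsub (0, 0)%Z v) with z; auto.
      unfold v, zsub; destruct z; cbn [fst snd]; f_equal; ring. }
    intros n; rewrite Hg; induction n as [|n IH].
    - rewrite sum_O, !Hstep; change (Nat.iter 0 (act P) A) with A; ring.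
    - rewrite sum_Sn_R, <- IH, !(Hstep (S n)); ring. }
  apply is_series_unique.
  change (is_lim_seq (sum_n (fun k => Pn p supp k (0, 0)%Z - Pn p supp k z)) (A z - A (0, 0)%Z)).
  apply is_lim_seq_spec.
  intros eps.
  destruct (iter_Decay1_vanish P x _ (eps / 2) probP HS Hx (HD v)) as [n0 Hn0].
  { destruct eps as [e He]; simpl; lra. }
  exists n0; intros n Hn; rewrite <- Hsum.
  specialize (Hn0 (S n) (0, 0)%Z ltac:(lia)).
  replace (A z - A (0, 0)%Z + Nat.iter (S n) (act P) (act (grad v) A) (0, 0)%Z - (A z - A (0, 0)%Z))
    with (Nat.iter (S n) (act P) (act (grad v) A) (0, 0)%Z) by ring.
  destruct eps as [e He]; simpl in *; lra.
Qed.

End Walk.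

Theorem mainTheorem6 (v1 v2 : C) (p : Z * Z -> R) (supp : list (Z * Z)) :
  lattice_basis v1 v2 ->
  step_law p supp ->
  spherical v1 v2 p supp ->
  irreducible_walk p supp ->
  forall K : nat, (1 <= K)%nat ->
  exists (alpha lambda : R) (idx : list (nat * nat)) (coef : nat * nat -> C),
    (forall lk, In lk idx ->
       (fst lk + 1 <= snd lk)%nat /\ (snd lk <= fst lk + K)%nat) /\
    (forall lk, In lk idx -> (2 * fst lk < snd lk)%nat -> coef lk = RtoC 0) /\
    exists (B M : R), 0 < M /\
      forall z : Z * Z, M <= Cmod (emb v1 v2 z) ->
        Rabs (harm_pot p supp z
              - (alpha * ln (Cmod (emb v1 v2 z)) + lambda
                 + Re (expansion coef idx (emb v1 v2 z))))
        <= B * / (Cmod (emb v1 v2 z) ^ K).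
Proof.
  intros Hbasis Hlaw Hsph Hirr K HK.
  destruct (fundamental_solution v1 v2 p supp Hbasis Hlaw Hsph Hirr K)
    as (A & alpha & Q & HA & HQ & B & M & HM & HB).
  destruct (Span_expansion K Q HQ) as (idx & coef & _ & Hidx & B' & M' & HM' & HB').
  destruct (Span_bigO 1 Q HQ) as (B1 & M1 & HM1 & HB1).
  (* As K >= 1, the error and the span of order 1 are both O(1 / |z|), hence so is A - alpha ln
     |z|. *)
  assert (HD : forall v, Decay 1 (act (grad v) A)).
  { intros v.
    apply (grad_log_Decay1 v1 v2 Hbasis A alpha v (Rabs B + B1) (M + M1)); [lra|].
    intros z Hz.
    assert (Z1 := HB z ltac:(lra)); assert (Z2 := HB1 (emb v1 v2 z) ltac:(lra)).
    assert (Z3 := re_le_Cmod (Q (emb v1 v2 z))); rewrite pow_1 in Z2.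
    set (r := Cmod (emb v1 v2 z)) in *.
    assert (Z4 : Rabs (A z - (alpha * ln r + Re (Q (emb v1 v2 z)))) <= Rabs B / r).
    { eapply Rle_trans; [exact Z1|].
      assert (0 < r ^ K) by (apply pow_lt; lra).
      apply Rle_trans with (Rabs B / r ^ K).
      - apply Rmult_le_compat_r; [apply Rlt_le, Rinv_0_lt_compat; auto | apply Rle_abs].
      - apply Rmult_le_compat_l; [apply Rabs_pos|]; apply Rinv_le_contravar; [lra|].
        rewrite <- (pow_1 r) at 1; apply Rle_pow; auto; lra. }
    replace (A z - alpha * ln r) with
      ((A z - (alpha * ln r + Re (Q (emb v1 v2 z)))) + Re (Q (emb v1 v2 z))) by ring.
    eapply Rle_trans; [apply Rabs_triang|]; unfold Rdiv in *; lra. }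
  exists alpha, (- A (0, 0)%Z), idx, coef; split; [|split].
  - intros lk Hlk; destruct (Hidx lk Hlk) as (? & ? & ?); auto.
  (* Every retained pair satisfies k <= 2 l, so the case l < k / 2 is contradictory. *)
  - intros lk Hlk Hlt; destruct (Hidx lk Hlk) as (? & ? & ?); lia.
  - exists (B + B'), (M + M'); split; [lra|]; intros z Hz.
    rewrite (harm_pot_fundamental v1 v2 p supp Hbasis Hlaw Hsph Hirr A HA HD z).
    specialize (HB z ltac:(lra)); specialize (HB' (emb v1 v2 z) ltac:(lra)).
    assert (Z3 := re_le_Cmod (Q (emb v1 v2 z) - expansion coef idx (emb v1 v2 z))%C).
    set (E := expansion coef idx (emb v1 v2 z)) in *.
    replace (A z - A (0, 0)%Z - (alpha * ln (Cmod (emb v1 v2 z)) + - A (0, 0)%Z + Re E)) with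
      ((A z - (alpha * ln (Cmod (emb v1 v2 z)) + Re (Q (emb v1 v2 z))))
       + Re (Q (emb v1 v2 z) - E)%C) by (unfold Re; simpl; ring).
    eapply Rle_trans; [apply Rabs_triang|].
    unfold Rdiv in *; lra.
Qed.
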